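(* Let $f=\sum a_nq^n\in S_2(\Gamma_0(N),\mathbf C)$ be a newform with $K_f=\mathbf Q$. For any sufficiently large prime $p$ and any embedding $\rho:\mathbf Z[1/N,\zeta_N]\to R_p$, let $f^\sharp\in M^2(\Gamma_1(N),R_p,0)$ be the unique $\delta$-eigenform whose $\delta$-Fourier expansion is (a) $f^\sharp_{\infty,\rho}=\frac1p\sum_{n\ge1}\frac{a_n}{n}(q^{n\phi^2}-a_pq^{n\phi}+pq^n)$, if $f$ is not of CM type, or if $f$ is of CM type corresponding to an imaginary quadratic field $\mathcal K$ in which $p$ does not split (in the latter case $a_p=0$); (b) $f^\sharp_{\infty,\rho}=\frac1p\sum_{n\ge1}\frac{a_n}{n}(q^{n\phi}-pu\,q^n)$, if $f$ is of CM type corresponding to $\mathcal K$ and $p$ splits in $\mathcal K$, where $pu$ is the unique root in $p\mathbf Z_p^\times$ of $x^2-a_px+p$. Then $f^\sharp_{\infty,\rho}$ is an eigenvector of $T(p)_\infty$ with eigenvalue $a_p=a_p(f)$.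
   Context: $p\ge5$ is a prime not dividing $N$; $R=R_p$ is the completion of the maximal unramified extension of $\mathbf Z_p$, $\phi:R\to R$ the lift of the $p$-power Frobenius on $R/pR$, $\delta x=(\phi(x)-x^p)/p$. $K_f$ is the field generated by the $a_n$. A newform $f$ of weight $2$ with $K_f=\mathbf Q$ determines by Eichler–Shimura an elliptic curve quotient $\pi:J_1(N)_{\mathbf Q}\to A$ over $\mathbf Q$, unique up to isogeny, with $\pi^*H^0(A_{\mathbf C},\Omega)=\mathbf Cf$; $f$ is of CM type corresponding to $\mathcal K$ if $A$ has complex multiplication by an order of $\mathcal K$. $M^2(\Gamma_1(N),R_p,0)$ denotes the $R_p$-module of $\delta$-modular forms of weight $0$ and order $2$ on $\Gamma_1(N)$: rules attaching functorially, to each prolongation sequence $S^*$ over $R$ of Noetherian $p$-adically complete rings and each isomorphism class of triples $(E/S^0,\alpha,\omega)$ ($E$ elliptic curve, $\alpha:(\mathbf Z/N\mathbf Z)_{S^0}\to E$ closed immersion of group schemes, $\omega$ invertible $1$-form), an element of $S^2$, independent of rescaling $\omega$ by units. (A prolongation sequence is a sequence of rings $S^n$ with ring homomorphisms $\varphi:S^n\to S^{n+1}$ and commuting $p$-derivations $\delta:S^n\to S^{n+1}$, i.e. maps with $\delta 1=0$ such that $\phi(x):=\varphi(x)^p+p\,\delta x$ obeys the formal identities of a ring homomorphism: $\delta(x+y)=\delta x+\delta y+\frac{\varphi(x)^p+\varphi(y)^p-(\varphi(x)+\varphi(y))^p}{p}$, $\delta(xy)=\varphi(x)^p\delta y+\varphi(y)^p\delta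 x+p\,\delta x\,\delta y$, the fraction being interpreted via the integral polynomial $(X^p+Y^p-(X+Y)^p)/p$; ''over $R$'' means equipped with a morphism from the constant sequence $R^n=R$.) The $\delta$-Fourier expansion $f_{\infty,\rho}$ is the value of the form at the Tate curve $\mathrm{Tate}(q)$ over $S^0_\infty$ with canonical level structure (via $\rho(\zeta_N)$) and canonical $1$-form, for the prolongation sequence $S^r_\infty=R_p((q))\hat{\ }[q',\dots,q^{(r)}]\hat{\ }$ ($\hat{\ }$ is $p$-adic completion, $\delta q^{(i)}=q^{(i+1)}$). A $\delta$-eigenform is a nonzero form that is an eigenvector of the Hecke operators $T(l)$, $l$ prime, $l\nmid Np$, where $T(l)h$ at $(E,\alpha,\omega)$ is the sum (after a finite étale extension making $E[l]$ constant) of $h$ over the quotients $u_i:E\to E/H_i$ by the $l+1$ subgroup schemes $H_i$ of rank $l$, with structures $u_i\circ\alpha$, $u_{i*}\omega$ (trace of $\omega$). For $p$ sufficiently large, the unique $f^\sharp$ in the claim exists. Its expansion, which lies in $R[[q,q',q'']]$, is given by the explicit series in the claim, where $q^{n\phi}=(q^p+pq')^n$ and $q^{n\phi^2}=[(q^p+pq')^p+p(q')^p+p^2q'']^n$. $\delta$-symmetric series. On power series in variables $q_i^{(j)}$ over $R$, extend $\phi$ by $\phi(q_i^{(j)})=(q_i^{(j)})^p+pq_i^{(j+1)}$ (with $q_i^{(0)}=q_i$) and let $\delta F=(\phi(F)-F^p)/p$; similarly for one variable $q$. Let $S_1,\dots,S_m$ be the fundamental symmetric polynomials in $q_1,\dots,q_m$.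 A series $G\in R[[q_1,\dots,q_m,\dots,q_1^{(r)},\dots,q_m^{(r)}]]$ is $\delta$-symmetric if there is a (necessarily unique) series $G_{(m)}\in R[[q_1,\dots,q_m,\dots,q_1^{(r)},\dots,q_m^{(r)}]]$ with $$G(q_1,\dots,q_m,\dots,q_1^{(r)},\dots,q_m^{(r)})=G_{(m)}(S_1,\dots,S_m,\dots,\delta^rS_1,\dots,\delta^rS_m).$$ For $F\in R[[q,\dots,q^{(r)}]]$ put $\Sigma_mF:=\sum_{i=1}^mF(q_i,\dots,q_i^{(r)})$. Hecke operator $T(p)_\infty$. If $F\in R[[q,\dots,q^{(r)}]]$ is such that $G:=\Sigma_pF$ is $\delta$-symmetric, put $$T(p)_\infty F:=F(q^p,\dots,\delta^r(q^p))+G_{(p)}(0,\dots,0,q,\dots,0,\dots,0,q^{(r)})\in R[[q,\dots,q^{(r)}]]$$ (in $G_{(p)}$ the slots of $\delta^iS_1,\dots,\delta^iS_{p-1}$ are set to $0$ and that of $\delta^iS_p$ to $q^{(i)}$, $0\le i\le r$). $F$ is an eigenvector of $T(p)_\infty$ with eigenvalue $\lambda\in R$ if $\Sigma_pF$ is $\delta$-symmetric and $T(p)_\infty F=\lambda F$. *)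

(* Defs.v *)
From HB Require Import structures.
From mathcomp Require Import all_boot all_order all_algebra.
From mathcomp Require Import complex.
From mathcomp Require Import -(notations) mpoly.
From mathcomp Require Import all_classical all_reals all_analysis.

Set Implicit Arguments.
Unset Strict Implicit.
Unset Printing Implicit Defensive.

Import Order.TTheory GRing.Theory Num.Theory numFieldNormedType.Exports.

Local Open Scope classical_set_scope.
Local Open Scope complex_scope.
Local Open Scope ring_scope.

(* The complex numbers are [K[i]], for [K] any model of the reals. *)

Section ModularForms.
Variable K : realType.
Local Notation C := K[i].
Implicit Types (z w : C) (f g : C -> C) (gam : 'M[int]_2) (N : nat).

Definition upper z : Prop := 0 < complex.Im z.

Definition ent gam (i j : 'I_2) : int := gam i j.

Definition denom gam z : C := (ent gam 1 0)%:~R * z + (ent gam 1 1)%:~R.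

Definition moebius gam z : C :=
  ((ent gam 0 0)%:~R * z + (ent gam 0 1)%:~R) / denom gam z.

Definition slash2 f gam z : C := (denom gam z) ^- 2 * f (moebius gam z).

Definition SL2Z : set 'M[int]_2 := [set gam | \det gam = 1].

Definition Gamma0 N : set 'M[int]_2 :=
  [set gam | SL2Z gam /\ ent gam 1 0 \in dvdz N].

Definition Gamma1 N : set 'M[int]_2 :=
  [set gam | [/\ Gamma0 N gam, ent gam 0 0 - 1 \in dvdz N
               & ent gam 1 1 - 1 \in dvdz N]].

Definition holomorphic_upper f : Prop :=
  forall z, upper z -> derivable (f : C^o -> C^o) z 1.

(* The last condition says that, at every cusp, [f] is holomorphic and
   vanishes. *)
Definition cusp_form2 N f : Prop :=
  [/\ holomorphic_upper f,
      forall gam z, Gamma0 N gam -> upper z -> slash2 f gam z = f z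
    & forall gam, SL2Z gam -> forall e : K, 0 < e ->
        exists Y : K, forall z, 0 < complex.Im z -> Y < complex.Im z ->
          `|slash2 f gam z| < e%:C ].

(* [qpar z = exp (2 pi i z)] *)
Definition qpar z : C :=
  (expR (- 2 * pi * complex.Im z))%:C
  * (cos (2 * pi * complex.Re z) +i* sin (2 * pi * complex.Re z)).

Definition q_expansion f (a : nat -> C) : Prop :=
  a 0%N = 0 /\
  forall z, upper z ->
    series (fun n => a n * qpar z ^+ n : C^o) @ \oo --> (f z : C^o).

(* The operator [T_l] of weight 2 and trivial nebentypus; for [l] dividing [N]
   this is [U_l]. *)
Definition hecke2 N (l : nat) f z : C :=
  l%:R^-1 * (\sum_(j < l) f ((z + j%:R) / l%:R))
  + (if (l %| N)%N then 0 else l%:R * f (l%:R * z)).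

Definition coset_reps N (s : seq 'M[int]_2) : Prop :=
  [/\ uniq s, forall al, al \in s -> SL2Z al
    & forall gam, SL2Z gam ->
        exists! al, al \in s /\ Gamma0 N (gam *m invmx al)].

Definition fund_domain : set (K * K) :=
  [set t | [/\ 0 < t.2, `|t.1| <= 2^-1 & 1 <= t.1 ^+ 2 + t.2 ^+ 2]].

(* In weight 2 the factor [y ^ 2] cancels the one of the measure
   [dx dy / y ^ 2]; the product is not divided by the volume of [X_0(N)],
   since only orthogonality is used. *)
Definition petersson (s : seq 'M[int]_2) f g : C :=
  let F (t : K * K) : C :=
    \sum_(al <- s) slash2 f al (t.1 +i* t.2) * (slash2 g al (t.1 +i* t.2))^* in
  (\int[(lebesgue_measure \x lebesgue_measure)%E]_(t in fund_domain) complex.Re (F t))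
  +i*
  (\int[(lebesgue_measure \x lebesgue_measure)%E]_(t in fund_domain) complex.Im (F t)).

(* Orthogonality to the old forms [g (z)], [g (l z)], [g] of level [N / l]. *)
Definition new_form_space N f : Prop :=
  forall s, coset_reps N s ->
  forall (l : nat) g, prime l -> (l %| N)%N -> cusp_form2 (N %/ l)%N g ->
    petersson s f g = 0 /\ petersson s f (fun z => g (l%:R * z)) = 0.

Definition newform2 N f (a : nat -> C) : Prop :=
  [/\ cusp_form2 N f, new_form_space N f, q_expansion f a, a 1%N = 1
    & forall l, prime l ->
        exists lam : C, forall z, upper z -> hecke2 N l f z = lam * f z].

Definition is_subring (A : set C) : Prop :=
  [/\ A 1, forall x y, A x -> A y -> A (x - y)
    & forall x y, A x -> A y -> A (x * y)].

Definition is_subfield (A : set C) : Prop :=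
  is_subring A /\ forall x, A x -> A x^-1.

Definition coef_field (a : nat -> C) : set C :=
  [set x | forall A, is_subfield A -> (forall n, A (a n)) -> A x].

Definition rationals : set C := [set ratr x | x in [set: rat]].

(* Since the upper half plane is simply connected, the integral of [f] from
   [z] to [gam z] is the variation of a primitive [F] of [f].  The periods
   along the closed paths of [X_1(N)] form the lattice [Lambda_f], and the
   quotient [A] of [J_1(N)] attached to [f] by Eichler and Shimura is, up to
   isogeny, the elliptic curve with [A(C) = C / Lambda_f]. *)
Definition period_lattice N f : set C :=
  [set w | exists F : C -> C, exists2 gam, Gamma1 N gam &
     (forall z, upper z -> is_derive (z : C^o) (1 : C^o) (F : C^o -> C^o) (f z))
     /\ (forall z, upper z -> w = F (moebius gam z) - F z)].

Definition lattice_End (L : set C) : set C :=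
  [set mu | forall w, L w -> L (mu * w)].

(* The imaginary quadratic field [Q(sqrt (- d))], for [0 < d]. *)
Definition imquad (d : nat) : set C :=
  [set x | exists a b : rat, x = ratr a + ratr b * (0 +i* Num.sqrt d%:R)].

Definition is_order_of (A F : set C) : Prop :=
  [/\ is_subring A, A `<=` F,
      exists k (g : 'I_k -> C), forall x,
        A x <-> exists c : 'I_k -> int, x = \sum_(i < k) (c i)%:~R * g i
    & forall x, F x -> exists2 n : nat, (0 < n)%N & A (n%:R * x)].

Definition CM_type N f (d : nat) : Prop :=
  (0 < d)%N /\ is_order_of (lattice_End (period_lattice N f)) (imquad d).

Definition integers_of (F : set C) : set C :=
  [set x | F x /\
     exists2 P : {poly int}, P \is monic & root (map_poly intr P) x].

Definition is_ideal_of (O I : set C) : Prop :=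
  [/\ I `<=` O, I 0, forall x y, I x -> I y -> I (x + y)
    & forall c x, O c -> I x -> I (c * x)].

Definition is_prime_of (O I : set C) : Prop :=
  [/\ is_ideal_of O I, ~ I 1
    & forall x y, O x -> O y -> I (x * y) -> I x \/ I y].

Definition ideal_mul (O I J : set C) : set C :=
  [set x | forall A, is_ideal_of O A ->
     (forall y z, I y -> J z -> A (y * z)) -> A x].

Definition splits_in (p : nat) (F : set C) : Prop :=
  let O := integers_of F in
  exists P Q, [/\ is_prime_of O P, is_prime_of O Q, P <> Q
    & ideal_mul O P Q = [set p%:R * x | x in O]].

(* [exp (2 pi i / N)] *)
Definition zetaN N : C := cos (2 * pi / N%:R) +i* sin (2 * pi / N%:R).

Definition cyclo_ring N : set C :=
  [set x | forall A, is_subring A -> A N%:R^-1 -> A (zetaN N) -> A x].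

(* [rho] is only meaningful on [cyclo_ring N]. *)
Definition ring_embedding (A : set C) (R : nzRingType) (rho : C -> R) : Prop :=
  [/\ rho 1 = 1,
      forall x y, A x -> A y -> rho (x - y) = rho x - rho y,
      forall x y, A x -> A y -> rho (x * y) = rho x * rho y
    & forall x y, A x -> A y -> rho x = rho y -> x = y].

End ModularForms.

Definition rdvd (S : nzRingType) (a x : S) : Prop := exists y, x = a * y.

Definition padic_complete (p : nat) (S : nzRingType) : Prop :=
  (forall x : S, (forall n, rdvd (p%:R ^+ n) x) -> x = 0) /\
  (forall x : nat -> S, (forall n, rdvd (p%:R ^+ n) (x n.+1 - x n)) ->
     exists y, forall n, rdvd (p%:R ^+ n) (y - x n)).

(* The completion of the maximal unramified extension of [Z_p], characterized
   up to isomorphism as the complete discrete valuation ring of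
   characteristic 0 with uniformizer [p] whose residue field is an algebraic
   closure of [F_p]; that every element of the residue field is algebraic over
   [F_p] is expressed by [x ^ (p ^ k) = x]. *)
Definition is_Rp (p : nat) (R : idomainType) : Prop :=
  [/\ p%:R != 0 :> R, padic_complete p R,
      forall x : R, x \is a GRing.unit <-> ~ rdvd p%:R x,
      forall P : {poly R}, P \is monic -> (1 < size P)%N ->
        exists x, rdvd p%:R P.[x]
    & forall x : R, exists2 k, (0 < k)%N & rdvd p%:R (x ^+ (p ^ k) - x)].

Definition Frobenius_lift (p : nat) (R : nzRingType) (phi : R -> R) : Prop :=
  forall x, rdvd p%:R (phi x - x ^+ p).

(* [Z_p] inside [R_p], as the closure of [Z]. *)
Definition in_Zp (p : nat) (R : nzRingType) (x : R) : Prop :=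
  forall n, exists m : nat, rdvd (p%:R ^+ n) (x - m%:R).

(* Quotient by [p]; to be used on multiples of [p] in a [p]-torsion free
   ring. *)
Definition divp (p : nat) (S : nzRingType) (x : S) : S :=
  xget 0 [set y | x = p%:R * y].

Definition delta (p : nat) (R : nzRingType) (phi : R -> R) (x : R) : R :=
  divp p (phi x - x ^+ p).

(* The integral polynomial [(x ^ p + y ^ p - (x + y) ^ p) / p]. *)
Definition Cp (p : nat) (S : nzRingType) (x y : S) : S :=
  - \sum_(1 <= k < p) (x ^+ k * y ^+ (p - k)) *+ ('C(p, k) %/ p).

Definition is_ideal (S : nzRingType) (I : set S) : Prop :=
  [/\ I 0, forall x y, I x -> I y -> I (x + y) & forall c x, I x -> I (c * x)].

Definition noetherian (S : nzRingType) : Prop :=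
  forall I : set S, is_ideal I ->
    exists k (g : 'I_k -> S), (forall i, I (g i)) /\
      forall x, I x -> exists c : 'I_k -> S, x = \sum_(i < k) c i * g i.

(* [prol_str] is the morphism from the constant sequence [R^n = R].  The rings
   are non-zero: a [delta]-modular form carries no information where its value
   lies in the zero ring. *)
Record prolongation (p : nat) (R : comNzRingType) (phi : R -> R) := Prolongation {
  prol_ring :> nat -> comNzRingType;
  prol_map : forall n, {rmorphism prol_ring n -> prol_ring n.+1};
  prol_del : forall n, prol_ring n -> prol_ring n.+1;
  prol_str : forall n, {rmorphism R -> prol_ring n};
  prol_del1 : forall n, prol_del (1 : prol_ring n) = 0;
  prol_delD : forall n (x y : prol_ring n),
    prol_del (x + y) =
      prol_del x + prol_del y + Cp p (prol_map n x) (prol_map n y);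
  prol_delM : forall n (x y : prol_ring n),
    prol_del (x * y) =
      prol_map n x ^+ p * prol_del y + prol_map n y ^+ p * prol_del x
      + p%:R * prol_del x * prol_del y;
  prol_comm : forall n (x : prol_ring n),
    prol_del (prol_map n x) = prol_map n.+1 (prol_del x);
  prol_str_map : forall n (x : R), prol_map n (prol_str n x) = prol_str n.+1 x;
  prol_str_del : forall n (x : R),
    prol_del (prol_str n x) = prol_str n.+1 (delta p phi x);
  prol_noeth : forall n, noetherian (prol_ring n);
  prol_complete : forall n, padic_complete p (prol_ring n)
}.

Record prol_morph (p : nat) (R : comNzRingType) (phi : R -> R)
    (S S' : prolongation p phi) := ProlMorph {
  pm_fun :> forall n, {rmorphism S n -> S' n};
  pm_map : forall n (x : S n),
    pm_fun n.+1 (prol_map S n x) = prol_map S' n (pm_fun n x);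
  pm_del : forall n (x : S n), pm_fun n.+1 (prol_del x) = prol_del (pm_fun n x);
  pm_str : forall n (x : R), pm_fun n (prol_str S n x) = prol_str S' n x
}.

(* All rings below are algebras over [R_p] with [5 <= p], so 6 is invertible
   and an isomorphism class of pairs ([E], [omega]) over [S] is the same thing
   as a pair ([A], [B]) with invertible discriminant:
   [E : y ^ 2 = x ^ 3 + A x + B], [omega = dx / 2y].  The coordinates of
   ([E], [mu omega]) are those of ([E], [omega]) with [A], [B], [x], [y]
   multiplied by [mu ^ -4], [mu ^ -6], [mu ^ -2], [mu ^ -3]. *)

Section Elliptic.
Variable S : comNzRingType.

Definition has_inv (x : S) : Prop := exists y, x * y = 1.

(* [None] is the origin, [Some (x, y)] an affine point.  The sections of a
   constant subgroup scheme are all of this form, since those attached to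
   non-zero elements are disjoint from the origin. *)
Definition point := option (S * S).

Definition px (P : point) : S := if P is Some (x, y) then x else 0.
Definition py (P : point) : S := if P is Some (x, y) then y else 0.

Definition on_curve (A B : S) (P : point) : Prop :=
  if P is Some (x, y) then y ^+ 2 = x ^+ 3 + A * x + B else True.

(* [P + Q + T = 0] in the group law.  For affine points: some line
   [y = c x + d] cuts out the divisor [P + Q + T], i.e.
   [x ^ 3 + A x + B - (c x + d) ^ 2 = (x - xP) (x - xQ) (x - xT)]. *)
Definition sum_zero (A B : S) (P Q T : point) : Prop :=
  match P, Q, T with
  | Some (x1, y1), Some (x2, y2), Some (x3, y3) =>
      exists c d,
        [/\ y1 = c * x1 + d, y2 = c * x2 + d & y3 = c * x3 + d] /\
        [/\ x1 + x2 + x3 = c ^+ 2,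
            x1 * x2 + x1 * x3 + x2 * x3 = A - 2%:R * c * d
          & x1 * x2 * x3 = d ^+ 2 - B]
  | Some (x1, y1), Some (x2, y2), None
  | Some (x1, y1), None, Some (x2, y2)
  | None, Some (x1, y1), Some (x2, y2) => x1 = x2 /\ y1 = - y2
  | None, None, None => True
  | _, _, _ => False
  end.

(* A closed immersion of the constant group scheme [G] into the curve.  A
   homomorphism [G -> E] is one as soon as it sends no non-zero element to the
   origin over any point of the base. *)
Definition const_subgroup (A B : S) (G : zmodType) (P : G -> point) : Prop :=
  [/\ forall g, P g = None <-> g = 0,
      forall g, on_curve A B (P g)
    & forall g h, sum_zero A B (P g) (P h) (P (- (g + h)))].

(* ['I_N.-1.+1] is the additive group [Z/N] for every [0 < N]. *)
Record triple (N : nat) := Triple {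
  tr_A : S;
  tr_B : S;
  tr_lev : 'I_N.-1.+1 -> point;
  tr_disc : has_inv (4%:R * tr_A ^+ 3 + 27%:R * tr_B ^+ 2);
  tr_levP : const_subgroup tr_A tr_B tr_lev
}.

(* [T'] is [T] with [omega] replaced by [mu^-1 omega]. *)
Definition rescaled (N : nat) (mu : S) (T T' : triple N) : Prop :=
  [/\ tr_A T' = mu ^+ 4 * tr_A T, tr_B T' = mu ^+ 6 * tr_B T
    & forall k, tr_lev T' k =
        omap (fun P => (mu ^+ 2 * P.1, mu ^+ 3 * P.2)) (tr_lev T k)].

(* [E[l]] is constant, trivialized by the restriction of [b] to [{0} x F_l^2];
   on [Z/N x {0}], [b] is the level structure. *)
Definition torsion_basis (N l : nat) (T : triple N)
    (b : 'I_N.-1.+1 * ('F_l * 'F_l) -> point) : Prop :=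
  const_subgroup (tr_A T) (tr_B T) b /\ forall k, b (k, 0) = tr_lev T k.

(* The [l + 1] lines of [F_l^2], each with a parametrization by [F_l]. *)
Definition line (l : nat) (i : option 'F_l) (t : 'F_l) : 'F_l * 'F_l :=
  if i is Some j then (t, t * j) else (0, t).

(* The quotient of [T] by the subgroup [H] of [E[l]] given by the [i]-th line,
   with the image of the level structure and the trace of [omega].  Velu's
   formulas give the equation [y ^ 2 = x ^ 3 + A' x + B'] and the isogeny
   [u : E -> E / H],
     [x (u P) = x (P) + \sum_(Q in H, Q <> 0) (x (P + Q) - x (Q))],
     [y (u P) = y (P) + \sum_(Q in H, Q <> 0) (y (P + Q) - y (Q))],
   for which [u^* (dx / 2y) = omega].  As [u_* u^* = l], the trace of [omega]
   is [l (dx / 2y)], hence the powers of [l]. *)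
Definition hecke_quotient (N l : nat) (T : triple N)
    (b : 'I_N.-1.+1 * ('F_l * 'F_l) -> point) (i : option 'F_l)
    (T' : triple N) : Prop :=
  let A := tr_A T in
  let B := tr_B T in
  let h t := b (0, line i t) in
  let A' := A - 5%:R * \sum_(t : 'F_l | t != 0) (3%:R * px (h t) ^+ 2 + A) in
  let B' := B - 7%:R * \sum_(t : 'F_l | t != 0)
    (5%:R * px (h t) ^+ 3 + 3%:R * A * px (h t) + 2%:R * B) in
  let x' k := \sum_t px (b (k, line i t)) - \sum_(t | t != 0) px (h t) in
  let y' k := \sum_t py (b (k, line i t)) - \sum_(t | t != 0) py (h t) in
  [/\ l%:R ^+ 4 * tr_A T' = A', l%:R ^+ 6 * tr_B T' = B'
    & forall k, k != 0 ->
        l%:R ^+ 2 * px (tr_lev T' k) = x' k /\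
        l%:R ^+ 3 * py (tr_lev T' k) = y' k].

End Elliptic.

Definition base_change (S S' : comNzRingType) (u : S -> S') (N : nat)
    (T : triple S N) (T' : triple S' N) : Prop :=
  [/\ tr_A T' = u (tr_A T), tr_B T' = u (tr_B T)
    & forall k, tr_lev T' k = omap (fun P => (u P.1, u P.2)) (tr_lev T k)].

Section DeltaForms.
Variables (p N : nat) (R : comNzRingType) (phi : R -> R).

(* The module [M^r(Gamma_1(N), R, 0)]. *)
Record dform (r : nat) := DForm {
  df_val :> forall S : prolongation p phi, triple (S 0%N) N -> S r;
  df_functorial : forall (S S' : prolongation p phi) (u : prol_morph S S')
      (T : triple (S 0%N) N) (T' : triple (S' 0%N) N),
    base_change (u 0%N) T T' -> @df_val S' T' = u r (@df_val S T);
  df_weight0 : forall (S : prolongation p phi) (mu : S 0%N)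
      (T T' : triple (S 0%N) N),
    has_inv mu -> rescaled mu T T' -> @df_val S T' = @df_val S T
}.

(* [T(l) h = lam h].  Every triple acquires constant [l]-torsion over a finite
   etale, faithfully flat extension of [S^0], to which the prolongation
   sequence extends uniquely, so the identity of [delta]-modular forms may
   be read on the triples with constant [l]-torsion, where the value
   of [T(l) h] is the sum over the [l + 1] quotients. *)
Definition hecke_eigen (r : nat) (h : dform r) (l : nat) (lam : R) : Prop :=
  forall (S : prolongation p phi) (T : triple (S 0%N) N)
      (b : 'I_N.-1.+1 * ('F_l * 'F_l) -> point (S 0%N))
      (Q : option 'F_l -> triple (S 0%N) N),
    torsion_basis T b -> (forall i, hecke_quotient T b i (Q i)) ->
    \sum_i h S (Q i) = prol_str S r lam * h S T.

Definition delta_eigenform (r : nat) (h : dform r) : Prop :=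
  (exists (S : prolongation p phi) (T : triple (S 0%N) N), h S T != 0) /\
  (forall l, prime l -> ~~ (l %| N * p)%N -> exists lam, hecke_eigen h l lam).

End DeltaForms.

(* A power series in [q] over [R] is the function of its coefficients. *)

Section Fourier.
Variables (p : nat) (R : idomainType) (phi : R -> R).
Variable S : prolongation p phi.

Definition ser_mul (F G : nat -> R) (n : nat) : R :=
  \sum_(i < n.+1) F i * G (n - i)%N.

Variable j : (nat -> R) -> S 0%N.

Definition qS : S 0%N := j (fun n => (n == 1%N)%:R).

(* The image of [q^(i)] in [S^r], for [i <= r]. *)
Fixpoint qder (r : nat) : nat -> S r :=
  if r is r'.+1 then
    fun i => if (i <= r')%N then prol_map S r' (@qder r' i)
             else prol_del (@qder r' r')
  else fun _ => qS.

Fixpoint from0 (r : nat) : S 0%N -> S r :=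
  if r is r'.+1 then fun x => prol_map S r' (@from0 r' x) else id.

Definition poly_val (r : nat) (H : mpoly r (S 0%N)) : S r :=
  mmap (@from0 r) (fun i : 'I_r => qder r i.+1) H.

(* [S] is the sequence [S_oo^r = R((q))^[q', ..., q^(r)]^], [j] being the map
   [R[[q]] -> S_oo^0].  The fourth and fifth conditions say that [S^0], which
   is [p]-adically complete, is the [p]-adic completion of
   [R((q)) = R[[q]][1/q]], and the last two that [S^r] is the [p]-adic
   completion of [S^0[q', ..., q^(r)]]: in both cases that the map is bijective
   modulo every [p ^ n]. *)
Definition fourier_sequence : Prop :=
  [/\ [/\ forall c : R, j (fun n => if n == 0%N then c else 0)
                        = prol_str S 0%N c,
          forall F G, j (fun n => F n + G n) = j F + j G
        & forall F G, j (ser_mul F G) = j F * j G],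
      has_inv qS,
      (forall n (x : S 0%N),
         exists F k, rdvd (p%:R ^+ n) (qS ^+ k * x - j F)) /\
      (forall n F, rdvd (p%:R ^+ n) (j F) -> forall i, rdvd (p%:R ^+ n) (F i)),
      forall r n (x : S r), exists H, rdvd (p%:R ^+ n) (x - @poly_val r H)
    & forall r n H, rdvd (p%:R ^+ n) (@poly_val r H) ->
        forall m, rdvd (p%:R ^+ n) (mcoeff m H)].

Definition sigma_div (k n : nat) : nat := \sum_(d <- divisors n) d ^ k.

(* [Tate(q)] with its form [dt / t] is
   [y ^ 2 = x ^ 3 - E_4 x / 48 + E_6 / 864], [dx / 2y]. *)
Definition tate_A (n : nat) : R :=
  if n == 0%N then - 48%:R^-1 else - (5 * sigma_div 3 n)%:R.

Definition tate_B (n : nat) : R :=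
  if n == 0%N then 864%:R^-1 else - (7%:R / 12%:R) * (sigma_div 5 n)%:R.

(* The coordinates of the point of parameter [t = z], [z] a root of unity:
   [x = 1/12 + \sum_k w_k / (1 - w_k) ^ 2 - 2 \sum_n sigma_1(n) q ^ n] and
   [y = 1/2 \sum_k w_k (1 + w_k) / (1 - w_k) ^ 3], where [w_k = q ^ k z] and
   [k] runs over [Z]; the terms with [k <> 0] are expanded in powers of
   [q]. *)
Definition tate_x (z : R) (n : nat) : R :=
  if n == 0%N then 12%:R^-1 + z / (1 - z) ^+ 2
  else \sum_(d <- divisors n) d%:R * (z ^+ d + z ^- d - 2%:R).

Definition tate_y (z : R) (n : nat) : R :=
  2%:R^-1 *
  (if n == 0%N then z * (1 + z) / (1 - z) ^+ 3
   else \sum_(d <- divisors n) (d ^ 2)%:R * (z ^+ d - z ^- d)).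

(* [zeta] is the image of [zeta_N]; the canonical level structure sends
   [k] in [Z/N] to the point of parameter [zeta ^ k]. *)
Definition is_tate (N : nat) (zeta : R) (T : triple (S 0%N) N) : Prop :=
  [/\ tr_A T = j tate_A, tr_B T = j tate_B
    & forall k : 'I_N.-1.+1, k != 0 ->
        tr_lev T k = Some (j (tate_x (zeta ^+ k)), j (tate_y (zeta ^+ k)))].

End Fourier.

(* Variables [q_0^(j), ..., q_(m-1)^(j)], [0 <= j <= r]: there are
   [r.+1 * m] of them, [q_i^(j)] having index [j * m + i].  A power series is
   the function of its coefficients. *)

Notation mser n R := (multinom n -> R).

(* The [k]-th variable, 0 if [n <= k]. *)
Definition mvar (R : comNzRingType) (n k : nat) : mpoly n R :=
  if insub k is Some i then mpolyX R (mnm1 i) else 0.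

Definition qvar (R : comNzRingType) (r m i j : nat) : mpoly (r.+1 * m) R :=
  mvar R (r.+1 * m) (j * m + i).

(* The substitution [F (t_0, t_1, ...)], for polynomials [t_i] without constant
   term: the monomials of [F] of degree larger than that of [mu] do not
   contribute to the coefficient of [mu]. *)
Definition subst (R : comNzRingType) (n n' : nat) (F : mser n R)
    (t : 'I_n -> mpoly n' R) : mser n' R :=
  fun mu => mcoeff mu
    (\sum_(k : bmultinom n (mdeg mu).+1)
       F (bmnm k) *: mmap1 t (bmnm k)).

Section DeltaSymmetric.
Variables (p : nat) (R : idomainType) (phi : R -> R) (r : nat).

(* [phi] sends [q_i^(j)], of index [k], to [(q_i^(j)) ^ p + p q_i^(j+1)].  It
   will only be applied to polynomials of order less than [r], so that the
   convention [q_i^(r+1) = 0] is immaterial. *)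
Definition phi_poly (m : nat) (P : mpoly (r.+1 * m) R) :
    mpoly (r.+1 * m) R :=
  mmap (fun c => mpolyC (r.+1 * m) (phi c))
    (fun k => mvar R (r.+1 * m) k ^+ p + p%:R * mvar R (r.+1 * m) (k + m)) P.

Definition delta_poly (m : nat) (P : mpoly (r.+1 * m) R) :
    mpoly (r.+1 * m) R :=
  delta p (@phi_poly m) P.

(* [S_(i+1)] in the variables [q_0, ..., q_(m-1)]. *)
Definition elem_sym (m i : nat) : mpoly (r.+1 * m) R :=
  mmap (@mpolyC (r.+1 * m) R) (fun k : 'I_m => qvar R r m k 0)
    (mesym m R i.+1).

(* The substitution of [delta^j S_(i+1)] for [q_i^(j)]. *)
Definition delta_sym_subst (m : nat) (G : mser (r.+1 * m) R) :
    mser (r.+1 * m) R :=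
  subst G (fun k => iter (k %/ m) (@delta_poly m) (elem_sym m (k %% m))).

(* [F (q_i, ..., q_i^(r))], for [F] in one variable [q]. *)
Definition in_var (m i : nat) (F : mser (r.+1 * 1) R) : mser (r.+1 * m) R :=
  subst F (fun j => qvar R r m i j).

Definition Sigma_ser (m : nat) (F : mser (r.+1 * 1) R) : mser (r.+1 * m) R :=
  fun mu => \sum_(i < m) @in_var m i F mu.

Definition delta_symmetric_by (m : nat) (G Gm : mser (r.+1 * m) R) : Prop :=
  delta_sym_subst Gm = G.

(* [F (q ^ p, delta (q ^ p), ..., delta^r (q ^ p))] *)
Definition Vp (F : mser (r.+1 * 1) R) : mser (r.+1 * 1) R :=
  subst F (fun j => iter j (@delta_poly 1) (qvar R r 1 0 0 ^+ p)).

(* [G_(p) (0, ..., 0, q, ..., 0, ..., 0, q^(r))] *)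
Definition last_slots (G : mser (r.+1 * p) R) : mser (r.+1 * 1) R :=
  subst G (fun k => if (k %% p == p.-1)%N then qvar R r 1 0 (k %/ p) else 0).

Definition Tp_eigen (F : mser (r.+1 * 1) R) (lam : R) : Prop :=
  exists2 Gp, delta_symmetric_by (@Sigma_ser p F) Gp
    & forall mu, Vp F mu + last_slots Gp mu = lam * F mu.

End DeltaSymmetric.

Definition mon3 (a b c : nat) : multinom (3 * 1) :=
  Multinom [tuple nth 0%N [:: a; b; c] i | i < 3 * 1].

(* The element [s] of [S_oo^2] is the series [F] of [R[[q, q', q'']]]: modulo
   [p ^ n], [F] is a polynomial in [q'], [q''] over [R[[q]]] with value [s]. *)
Definition expansion (p : nat) (R : idomainType) (phi : R -> R)
    (S : prolongation p phi) (j : (nat -> R) -> S 0%N)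
    (s : S 2%N) (F : mser (3 * 1) R) : Prop :=
  forall n, exists D : nat,
    (forall a b c, (D <= b + c)%N -> rdvd (p%:R ^+ n) (F (mon3 a b c))) /\
    rdvd (p%:R ^+ n)
      (s - \sum_(b < D) \sum_(c < D)
             from0 2 (j (fun a => F (mon3 a b c)))
             * qder j 2 1 ^+ b * qder j 2 2 ^+ c).

Section Series.
Variables (p : nat) (R : idomainType) (a : nat -> rat).
Local Notation L := {fraction R}.
Local Notation q i := (qvar L 2 1 0 i).

Definition inL (x : R) : L := tofrac x.

Definition q_phi : mpoly (3 * 1) L := q 0%N ^+ p + p%:R * q 1%N.

Definition q_phi2 : mpoly (3 * 1) L :=
  (q 0%N ^+ p + p%:R * q 1%N) ^+ p + p%:R * q 1%N ^+ p
  + p%:R ^+ 2 * q 2%N.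

(* [\sum_(n >= 1) (a_n / n) P_n], where every monomial of [P_n] has degree at
   least [n]. *)
Definition series_sum (P : nat -> mpoly (3 * 1) L) : mser (3 * 1) L :=
  fun mu => \sum_(1 <= n < (mdeg mu).+1)
    ratr (a n) / n%:R * mcoeff mu (P n).

Definition series_a (F : mser (3 * 1) R) : Prop :=
  forall mu, inL (F mu) = p%:R^-1 *
    series_sum (fun n => q_phi2 ^+ n - ratr (a p) *: q_phi ^+ n
                         + p%:R *: q 0%N ^+ n) mu.

Definition series_b (u : R) (F : mser (3 * 1) R) : Prop :=
  forall mu, inL (F mu) = p%:R^-1 *
    series_sum (fun n => q_phi ^+ n - (p%:R * inL u) *: q 0%N ^+ n) mu.

(* [p u] is a root in [p Z_p^*] of [x ^ 2 - a_p x + p]; it is the only one,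
   the other root being a unit. *)
Definition is_u (u : R) : Prop :=
  [/\ in_Zp p u, u \is a GRing.unit
    & (p%:R * inL u) ^+ 2 - ratr (a p) * (p%:R * inL u) + p%:R = 0].

End Series.

Definition sharp_series (K : realType) (N : nat) (f : K[i] -> K[i])
    (a : nat -> rat) (p : nat) (R : idomainType) (F : mser (3 * 1) R) : Prop :=
  ((~ (exists d, CM_type N f d)
    \/ exists2 d, CM_type N f d & ~ splits_in p (@imquad K d))
   /\ series_a p a F)
  \/
  ((exists2 d, CM_type N f d & splits_in p (@imquad K d))
   /\ exists2 u, is_u p a u & series_b p a u F).

(* [h] is the unique [delta]-eigenform with expansion [F]; [T] is meant to be
   the Tate curve over [S]. *)
Definition unique_eigenform (p N : nat) (R : idomainType) (phi : R -> R)
    (S : prolongation p phi) (j : (nat -> R) -> S 0%N)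
    (T : triple (S 0%N) N) (F : mser (3 * 1) R) (h : dform p N phi 2) : Prop :=
  [/\ delta_eigenform h, expansion j (h S T) F
    & forall h' : dform p N phi 2,
        delta_eigenform h' -> expansion j (h' S T) F ->
        forall (S' : prolongation p phi) (T' : triple (S' 0%N) N),
          h' S' T' = h S' T'].

(* Main.v *)
Require Import Defs.
From HB Require Import structures.
From mathcomp Require Import all_boot all_order all_algebra.
From mathcomp Require Import complex.
From mathcomp Require Import -(notations) mpoly.
From mathcomp Require Import all_classical all_reals all_analysis.
From mathcomp Require Import zify ring lra.

Set Implicit Arguments.
Unset Strict Implicit.
Unset Printing Implicit Defensive.
Import Order.TTheory GRing.Theory Num.Theory numFieldNormedType.Exports.
Local Open Scope classical_set_scope.
Local Open Scope complex_scope.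
Local Open Scope ring_scope.

(* Write [psi = \sum_n (a_n / n) q ^ n].  In both cases [F] is a combination
   [al phi^2 psi + be phi psi + ga psi].  Hence [\sum_i F (q_i)] comes from the
   same combination of the series [\sum_n (a_n / n) P_n (S_1, ..., S_p)], where
   [P_n] expresses the [n]-th power sum by the elementary symmetric functions:
   [phi] commutes with polynomials over [Z], and [phi S], [phi^2 S] are
   polynomials in [S], [delta S], [delta^2 S].  The slots
   [(0, ..., 0, q)] make [P_n] vanish unless [p] divides [n], and give
   [p q ^ (n / p)] otherwise; so [T(p)] acts on the [a_n] as
   [a_n |-> a_(p n) + p a_(n / p) = a_p a_n].  The last relation follows from the
   uniqueness of the [q]-expansion.

   The point is that the symmetrized series has coefficients in [R].  With [P_n]
   written as the trace of the [n]-th power of a companion matrix, its derivative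
   is divisible by [n], so congruent arguments modulo [p] give values congruent
   modulo [p n]; in particular [P_n (phi^i S)] and [P_(p^i n) (S)] agree modulo
   [p n].  After this replacement what is left is [\sum_m c_m P_m], where [c_m] is
   the coefficient of [q ^ m] in [F], which is in [R] by assumption.  The
   integrality of the [a_n] is also read off from the coefficients of [F]. *)

(** * Power sums as traces *)

Section PowerSums.
Variables (D : comNzRingType) (p : nat).
Implicit Types (s t : nat -> D).

(* Companion matrix of [X^p - s_0 X^(p-1) + s_1 X^(p-2) - ...]. *)
Definition companion s : 'M[D]_p :=
  \matrix_(i, j) if i.+1 == p then (-1) ^+ (p - j).-1 * s (p - j).-1
                 else (i.+1 == j)%:R.

(* The [n]-th power sum as a polynomial in the elementary symmetric
   functions. *)
Definition newton s (n : nat) : D := \tr (companion s ^+ n).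

Lemma eq_newton s t n :
  (forall j, (j < p)%N -> s j = t j) -> newton s n = newton t n.
Proof.
move=> st; rewrite /newton; congr (\tr (_ ^+ n)).
apply/matrixP => i j; rewrite !mxE; case: ifP => // _.
by rewrite st // prednK ?subn_gt0 ?ltn_ord // leq_subr.
Qed.

End PowerSums.

Lemma map_mxX (D D' : comNzRingType) (f : {rmorphism D -> D'}) (p n : nat)
  (A : 'M[D]_p) : map_mx f (A ^+ n) = map_mx f A ^+ n.
Proof.
elim: n => [|n IH]; first by rewrite !expr0 [LHS]map_mx1.
by rewrite !exprS [LHS]map_mxM IH.
Qed.

Lemma map_newton (D D' : comNzRingType) (f : {rmorphism D -> D'}) (p n : nat)
  (s : nat -> D) : f (newton p s n) = newton p (f \o s) n.
Proof.
rewrite /newton -trace_map_mx map_mxX; congr (\tr (_ ^+ n)).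
apply/matrixP => i j; rewrite !mxE.
by case: ifP => _; rewrite /= ?rmorph_nat // rmorphM /= rmorphXn /= rmorphN1.
Qed.

(** As [p] is odd, the sign [(-1) ^ (p - 1)] of the remaining entry is 1, so the matrix is a cyclic
    shift that picks up a factor [y] at each wrap. Row [i] of the [n]-th power has its only entry at
    the remainder of [i + n], and the quotient counts the wraps. *)
Lemma companion_lastX (D : comNzRingType) (p n : nat) (y : D) : odd p ->
  companion p (fun j => if j == p.-1 then y else 0) ^+ n =
  \matrix_(i, j) if ((i + n) %% p == j)%N then y ^+ ((i + n) %/ p) else 0.
Proof.
move=> p_odd; have p_gt0 : (0 < p)%N by case: p p_odd.
elim: n => [|n IH]; apply/matrixP => i j.
  by rewrite expr0 !mxE addn0 modn_small // divn_small // expr0 -val_eqE;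
     case: eqP.
rewrite exprSr IH -[LHS]/((_ *m _) i j) !mxE.
have lt_m : ((i + n) %% p < p)%N by rewrite ltn_mod.
rewrite (bigD1 (Ordinal lt_m)) //= big1 ?addr0 => [|k /eqP k_neq]; last first.
  rewrite mxE ifF ?mul0r //; apply/eqP => E; apply: k_neq.
  exact/val_inj.
rewrite !mxE eqxx /= addnS.
have [Em|nEm] := eqVneq ((i + n) %% p).+1 p.
  have dvd_p : (p %| (i + n).+1)%N.
    by rewrite (divn_eq (i + n) p) -addnS Em dvdn_add ?dvdn_mull.
  have -> : (((i + n).+1) %% p = 0)%N by apply/eqP.
  have -> : ((i + n).+1 %/ p = ((i + n) %/ p).+1)%N.
    rewrite {1}(divn_eq (i + n) p) -addnS Em.
    by rewrite -mulSnr mulnK.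
  have -> : ((p - j).-1 == p.-1) = (0 == j :> nat)%N.
    have := ltn_ord j; case: (nat_of_ord j) => [|j'] lt_j; first by rewrite subn0 eqxx.
    by apply/negbTE/eqP; move: lt_j; lia.
  case: eqP => [<-|_]; last by rewrite !mulr0.
  rewrite subn0 exprS mulrCA -signr_odd mulrC.
  have -> : odd p.-1 = false by move: p_odd; rewrite -{1}(prednK p_gt0) /=; case: odd.
  by rewrite mulr1 mulrC.
have lt_S : (((i + n) %% p).+1 < p)%N by rewrite ltn_neqAle nEm.
have -> : ((i + n).+1 %% p = ((i + n) %% p).+1)%N.
  by rewrite {1}(divn_eq (i + n) p) -addnS modnMDl modn_small.
have -> : ((i + n).+1 %/ p = (i + n) %/ p)%N.
  by rewrite {1}(divn_eq (i + n) p) -addnS divnMDl // (divn_small lt_S) addn0.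
by case: eqP => _; rewrite ?mulr1 ?mulr0.
Qed.

(** A cyclic shift by [n] has fixed points only when [p] divides [n]; then all [p] diagonal entries
    are [y ^ (n / p)]. *)
Lemma newton_last (D : comNzRingType) (p n : nat) (y : D) : odd p ->
  newton p (fun j => if j == p.-1 then y else 0) n =
  if (p %| n)%N then p%:R * y ^+ (n %/ p) else 0.
Proof.
move=> p_odd; have p_gt0 : (0 < p)%N by case: p p_odd.
rewrite /newton companion_lastX // /mxtrace.
case: ifP => [/dvdnP [k ->]|ndvd].
  rewrite mulnK // (eq_bigr (fun=> y ^+ k)) => [|i _].
    by rewrite sumr_const card_ord mulr_natl.
  by rewrite mxE addnC modnMDl modn_small // eqxx divnMDl // divn_small // addn0.
apply: big1 => i _; rewrite mxE ifF //; apply/eqP => E.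
have := congr1 (modn^~ p) E; rewrite modn_mod => /eqP.
by rewrite -{2}[nat_of_ord i]addn0 eqn_modDl mod0n => /eqP /eqP; rewrite -/(dvdn _ _) ndvd.
Qed.

Section Roots.
Variables (D : idomainType) (p : nat) (x : p.-tuple D).

Definition esym_at (j : nat) : D := meval (tnth x) (mesym p D j.+1).

(** Viete's formulas for the polynomial with roots [x_i], with the leading term isolated; moving the
    others across lowers each exponent of the sign by one. *)
Lemma companion_esym_at (k : 'I_p) :
  \sum_(j < p) (-1) ^+ (p - j).-1 * esym_at (p - j).-1 * tnth x k ^+ j
  = tnth x k ^+ p.
Proof.
pose P : {poly D} := \prod_(c <- x) ('X - c%:P).
have szP : size P = p.+1 by rewrite size_prod_XsubC size_tuple.
have : P.[tnth x k] = 0.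
  by apply/eqP; rewrite -/(root P _) root_prod_XsubC mem_tnth.
have PE (j : nat) : (j <= p)%N ->
    P`_j = (-1) ^+ (p - j) * meval (tnth x) (mesym p D (p - j)).
  move=> le_j; have lt_j : (p - j < p.+1)%N by rewrite ltnS leq_subr.
  have := mroots_coeff x (Ordinal lt_j); rewrite /= subKn //; exact.
rewrite horner_coef szP big_ord_recr /= PE // subnn mesym0E expr0 mul1r.
rewrite meval1 mul1r => /eqP; rewrite addrC addr_eq0 => /eqP ->.
rewrite -sumrN; apply: eq_bigr => j _; rewrite PE ?(ltnW (ltn_ord j)) //.
have := ltn_ord j; rewrite -subn_gt0 => /prednK; rewrite /esym_at => E.
by rewrite E -[in RHS]E exprS mulN1r !mulNr opprK E.
Qed.

Hypothesis x_inj : injective (tnth x).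

(* The Vandermonde matrix of [x] diagonalizes the companion matrix. *)
Lemma newton_esym_at (n : nat) : newton p esym_at n = \sum_(i < p) tnth x i ^+ n.
Proof.
pose v : 'rV[D]_p := \row_i tnth x i.
pose V := Vandermonde p v; pose d := diag_mx v.
have detV : \det V != 0.
  rewrite det_Vandermonde; apply/prodf_neq0 => i _; apply/prodf_neq0 => j lt_ij.
  rewrite !mxE subr_eq0; apply: contraTneq lt_ij => /x_inj ->.
  by rewrite ltnn.
have CV : companion p esym_at *m V = V *m d.
  apply/matrixP => i k; rewrite mul_mx_diag !mxE.
  have [Ei|nEi] := eqVneq i.+1 p.
    rewrite -exprSr Ei -companion_esym_at; apply: eq_bigr => j _.
    by rewrite !mxE Ei eqxx.
  have lt_i : (i.+1 < p)%N by rewrite ltn_neqAle nEi ltn_ord.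
  rewrite (bigD1 (Ordinal lt_i)) //= big1 ?addr0 => [|j /eqP j_neq].
    by rewrite !mxE (negPf nEi) eqxx mul1r exprSr.
  rewrite !mxE (negPf nEi); case: eqP => [E|]; last by rewrite mul0r.
  by case: j_neq; apply: val_inj.
have CVn : companion p esym_at ^+ n *m V = V *m (d ^+ n).
  elim: n => [|n IH]; first by rewrite !expr0 [LHS]mul1mx [RHS]mulmx1.
  rewrite exprS exprSr -[_ * _ *m V]mulmxA IH mulmxA CV.
  by rewrite -mulmxA -[X in _ = _ *m X]/(d ^+ n *m d) -[LHS]/(V *m (d * d ^+ n)) -exprS exprSr.
have dn : d ^+ n = diag_mx (\row_i tnth x i ^+ n).
  elim: n {CVn} => [|n IH]; last first.
    rewrite exprSr IH -[LHS]/(_ *m diag_mx v) mulmx_diag; congr diag_mx.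
    by apply/rowP => i; rewrite !mxE exprSr.
  rewrite expr0 -[LHS]diag_const_mx; congr diag_mx.
  by apply/rowP => i; rewrite !mxE expr0.
(* Conjugation by [V] is replaced by multiplication by [\det V] and use of the adjugate, since [V]
   is only known to have non-zero determinant. *)
apply: (mulfI detV); rewrite -mxtraceZ.
have -> : \det V *: (companion p esym_at ^+ n) = companion p esym_at ^+ n *m V *m \adj V.
  by rewrite -mulmxA mul_mx_adj mul_mx_scalar.
rewrite CVn -mulmxA mxtrace_mulC -mulmxA mul_adj_mx mul_mx_scalar mxtraceZ.
rewrite dn mxtrace_diag; congr (_ * _); apply: eq_bigr => i _.
by rewrite mxE.
Qed.

End Roots.

(** * Congruences between power sums *)

Section Congruence.
Variables (D : comNzRingType) (p : nat).

Lemma deriv_mxX (q n : nat) (A : 'M[{poly D}]_q) :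
  map_mx (@deriv D) (A ^+ n) =
  \sum_(i < n) A ^+ i *m map_mx (@deriv D) A *m A ^+ (n - i.+1).
Proof.
elim: n => [|n IH].
  rewrite big_ord0 expr0; apply/matrixP => i j; rewrite !mxE.
  by rewrite -polyC_natr derivC.
have derivMmx (B C : 'M[{poly D}]_q) : map_mx (@deriv D) (B *m C) =
    map_mx (@deriv D) B *m C + B *m map_mx (@deriv D) C.
  apply/matrixP => i j; rewrite !mxE raddf_sum -big_split /=.
  by apply: eq_bigr => k _; rewrite derivM !mxE.
rewrite exprSr -[A ^+ n * A]/(A ^+ n *m A) derivMmx IH big_ord_recr /=.
rewrite subnn expr0 -[X in _ = _ + X]/(A ^+ n *m map_mx (@deriv D) A * 1) mulr1.
congr (_ + _); rewrite mulmx_suml; apply: eq_bigr => i _.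
by rewrite -mulmxA -[A ^+ _ *m A]/(A ^+ _ * A) -exprSr subSn.
Qed.

(** By cyclicity of the trace, the [n] Leibniz terms of the derivative of [A ^ n] all have the same
    trace. *)
Lemma deriv_trX (q n : nat) (A : 'M[{poly D}]_q) :
  (\tr (A ^+ n))^`() = n%:R * \tr (A ^+ n.-1 *m map_mx (@deriv D) A).
Proof.
have -> : (\tr (A ^+ n))^`() = \tr (map_mx (@deriv D) (A ^+ n)).
  by rewrite /mxtrace raddf_sum; apply: eq_bigr => i _; rewrite mxE.
rewrite deriv_mxX raddf_sum /= (eq_bigr (fun=> \tr (A ^+ n.-1 *m map_mx (@deriv D) A))).
  by rewrite sumr_const card_ord mulr_natl.
move=> i _; rewrite -mulmxA mxtrace_mulC -mulmxA mxtrace_mulC.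
rewrite -[A ^+ _ *m A ^+ _]/(A ^+ _ * A ^+ _) -exprD.
by congr (\tr (A ^+ _ *m _)); have := ltn_ord i; lia.
Qed.

Hypothesis p_div : forall k : nat, exists z : D, p%:R ^+ k = k.+1%:R * z.

(** The difference is [g(p) - g(0)] for the polynomial [g(X) = \tr ((A + X B) ^ n)]. Since [n]
    divides the derivative of [g], it divides [(k + 1) g_(k+1)]; by [p_div], [p ^ (k + 1) g_(k+1)]
    is [p] times a multiple of [(k + 1) g_(k+1)]. No division takes place, so torsion in [D] is
    harmless. *)
Lemma trX_congr (q n : nat) (A B : 'M[D]_q) :
  exists y, \tr ((A + p%:R *: B) ^+ n) - \tr (A ^+ n) = p%:R * n%:R * y.
Proof.
pose M : 'M[{poly D}]_q := map_mx polyC A + 'X *: map_mx polyC B.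
pose g := \tr (M ^+ n).
have g_eval z : g.[z] = \tr ((A + z *: B) ^+ n).
  rewrite /g -[LHS]/(horner_eval z (\tr (M ^+ n))) -trace_map_mx.
  rewrite map_mxX; congr (\tr (_ ^+ n)); apply/matrixP => i j.
  by rewrite !mxE /= /horner_eval !hornerE.
have -> : \tr (A ^+ n) = g.[0] by rewrite g_eval scale0r addr0.
rewrite -g_eval.
have g_coef k : exists w, g`_k.+1 * k.+1%:R = n%:R * w.
  have /(congr1 (coefp k)) := deriv_trX n M; rewrite /coefp -/g coef_deriv mulr_natr => ->.
  by exists (\tr (M ^+ n.-1 *m map_mx (@deriv D) M))`_k; rewrite !mulr_natl coefMn.
suff gk k : exists y, g`_k * p%:R ^+ k - g`_k * 0 ^+ k = p%:R * n%:R * y.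
  rewrite !horner_coef -sumrB.
  elim/big_ind: _ => [|u v [y ->] [z ->]|k _]; last exact: gk.
    by exists 0; rewrite mulr0.
  by exists (y + z); rewrite mulrDr.
case: k => [|k]; first by exists 0; rewrite !expr0 subrr mulr0.
have [z Ez] := p_div k; have [w Ew] := g_coef k.
exists (w * z); rewrite expr0n mulr0 subr0 exprS Ez.
by rewrite -mulrA [n%:R * _]mulrA -Ew mulrCA !mulrA.
Qed.

(** The companion matrix is affine in [s], only its last row depending on [s], so [trX_congr]
    applies. *)
Lemma newton_congr (n : nat) (s t u : nat -> D) :
  (forall j, (j < p)%N -> s j = t j + p%:R * u j) ->
  exists y, newton p s n - newton p t n = p%:R * n%:R * y.
Proof.
move=> stu.
pose B : 'M[D]_p := \matrix_(i, j)
  if i.+1 == p then (-1) ^+ (p - j).-1 * u (p - j).-1 else 0.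
have [y Ey] := trX_congr n (companion p t) B; exists y; rewrite -Ey.
congr (\tr (_ ^+ n) - _); apply/matrixP => i j; rewrite !mxE.
case: ifP => _; last by rewrite mulr0 addr0.
rewrite stu; last by rewrite prednK ?subn_gt0 ?ltn_ord // leq_subr.
by rewrite mulrDr [p%:R * (_ * _)]mulrCA.
Qed.

End Congruence.

(** * Order and substitution of power series *)

Section Order.
Variables (n : nat) (R : comNzRingType).
Implicit Types (P Q : mpoly n R).

Definition ord_ge (d : nat) P : Prop :=
  forall k, (mdeg k < d)%N -> mcoeff k P = 0.

Lemma ord_ge0n P : ord_ge 0 P. Proof. by []. Qed.

Lemma ord_geW d e P : (d <= e)%N -> ord_ge e P -> ord_ge d P.
Proof. by move=> le_de eP k lt_k; apply: eP; apply: leq_trans le_de. Qed.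

Lemma ord_geD d P Q : ord_ge d P -> ord_ge d Q -> ord_ge d (P + Q).
Proof. by move=> dP dQ k lt_k; rewrite mcoeffD dP // dQ // addr0. Qed.

Lemma ord_geM d e P Q : ord_ge d P -> ord_ge e Q -> ord_ge (d + e) (P * Q).
Proof.
move=> dP eQ k lt_k; rewrite mcoeffM big1 // => -[k1 k2] /= /eqP Ek.
have [lt1|ge1] := ltnP (mdeg k1) d; first by rewrite dP // mul0r.
have [lt2|ge2] := ltnP (mdeg k2) e; first by rewrite eQ // mulr0.
by have := leq_add ge1 ge2; rewrite -mdegD -Ek leqNgt lt_k.
Qed.

Lemma ord_geMr d P Q : ord_ge d P -> ord_ge d (Q * P).
Proof. by move=> dP; apply: (@ord_geM 0). Qed.

Lemma ord_geZ d c P : ord_ge d P -> ord_ge d (c *: P).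
Proof. by move=> dP k lt_k; rewrite mcoeffZ dP // mulr0. Qed.

Lemma ord_geX d e P : ord_ge d P -> ord_ge (d * e) (P ^+ e).
Proof.
move=> dP; elim: e => [|e IH]; first by rewrite muln0.
by rewrite exprS mulnS; apply: ord_geM.
Qed.

Lemma ord_ge_sum (I : Type) (r : seq I) (A : pred I) (F : I -> mpoly n R) d :
  (forall i, A i -> ord_ge d (F i)) -> ord_ge d (\sum_(i <- r | A i) F i).
Proof.
move=> dF; elim/big_ind: _ => //; first by move=> k _; rewrite mcoeff0.
exact: ord_geD.
Qed.

Lemma ord_ge1P P : mcoeff (@mnm0 n) P = 0 -> ord_ge 1 P.
Proof. by move=> P0 k; rewrite ltnS leqn0 mdeg_eq0 => /eqP ->. Qed.

End Order.

Lemma ord_ge_mvar n (R : comNzRingType) k : ord_ge 1 (mvar R n k).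
Proof.
rewrite /mvar; case: insubP => [i _ _|_]; apply: ord_ge1P; last by rewrite mcoeff0.
by rewrite mcoeffX -mdeg_eq0 mdeg1.
Qed.

Lemma ord_ge_mmap1 n n' (R : comNzRingType) (t : 'I_n -> mpoly n' R) k :
  (forall i, ord_ge 1 (t i)) -> ord_ge (mdeg k) (mmap1 t k).
Proof.
move=> t1; rewrite mdegE /mmap1.
elim/big_ind2: _ => // [P a Q b|i _]; first exact: ord_geM.
by have := @ord_geX _ _ 1 (k i) _ (t1 i); rewrite mul1n.
Qed.

Lemma ord_ge_mmap n n' (R : nzRingType) (S : comNzRingType) (g : R -> mpoly n' S)
    (t : 'I_n -> mpoly n' S) d P :
  (forall i, ord_ge 1 (t i)) -> (forall k, (mdeg k < d)%N -> mcoeff k P = 0) ->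
  ord_ge d (mmap g t P).
Proof.
move=> t1 dP; rewrite /mmap big_seq; apply: ord_ge_sum => k.
rewrite mcoeff_msupp => Pk; apply: ord_geMr.
apply: ord_geW (@ord_ge_mmap1 _ _ _ _ k t1).
by rewrite leqNgt; apply: contra_neqN Pk; exact: dP.
Qed.

(** Modulo the augmentation ideal the companion matrix is a nilpotent shift, whose [p]-th power is
    0. So each further factor of [p] matrices raises the order of the entries by at least one. *)
Lemma ord_ge_newton n (R : comNzRingType) p d e (s : nat -> mpoly n R) :
  odd p -> (forall j, ord_ge 1 (s j)) -> (p * d <= e)%N ->
  ord_ge d (newton p s e).
Proof.
move=> p_odd s1 le_de; have p_gt0 : (0 < p)%N by case: p p_odd {le_de}.
have mulmx_ord a b (A B : 'M[mpoly n R]_p) : (forall i j, ord_ge a (A i j)) ->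
    (forall i j, ord_ge b (B i j)) -> forall i j, ord_ge (a + b) ((A * B) i j).
  move=> aA bB i j; rewrite mxE; apply: ord_ge_sum => k _; exact: ord_geM.
have cp1 i j : ord_ge 1 ((companion p s ^+ p) i j).
  apply: ord_ge1P.
  have := congr1 (fun A : 'M[R]_p => A i j) (map_mxX (mcoeff (@mnm0 n)) p (companion p s)).
  rewrite mxE => ->.
  (* The zero slots are written as an instance of [companion_lastX] with [y = 0]; after [p] steps
     every row has wrapped at least once. *)
  have -> : map_mx (mcoeff (@mnm0 n)) (companion p s) =
            companion p (fun j => if j == p.-1 then 0 else 0).
    apply/matrixP => i' j'; rewrite !mxE if_same.
    case: ifP => _; last by rewrite /= rmorph_nat.
    by rewrite rmorphM /= (s1 _ (@mnm0 n)) ?mulr0 ?mdeg0.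
  rewrite (companion_lastX _ _ p_odd) mxE expr0n.
  by rewrite divnDr ?dvdnn // divnn p_gt0 addn1 if_same.
have cpd i j : ord_ge d ((companion p s ^+ (p * d)) i j).
  rewrite exprM; elim: d {le_de} i j => [//|d IH] i j.
  by rewrite exprS -[d.+1]add1n; apply: mulmx_ord.
rewrite -(subnKC le_de) /newton exprD; apply: ord_ge_sum => i _.
by have := mulmx_ord d 0%N _ _ cpd (fun _ _ => @ord_ge0n _ _ _) i i; rewrite addn0; apply.
Qed.

Section Mmap.
Variables (n : nat) (R S S' : comNzRingType).

Lemma rmorph_mmap (g : {rmorphism S -> S'}) (f : {rmorphism R -> S})
    (h : 'I_n -> S) (P : mpoly n R) :
  g (mmap f h P) = mmap (g \o f) (g \o h) P.
Proof.
rewrite /mmap rmorph_sum; apply: eq_bigr => m _; rewrite rmorphM; congr (_ * _).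
by rewrite /mmap1 rmorph_prod; apply: eq_bigr => i _; rewrite rmorphXn.
Qed.

Lemma eq_mmap (f f' : R -> S) (h h' : 'I_n -> S) (P : mpoly n R) :
  f =1 f' -> h =1 h' -> mmap f h P = mmap f' h' P.
Proof.
move=> ff' hh'; apply: eq_bigr => m _; rewrite ff'; congr (_ * _).
by apply: eq_bigr => i _; rewrite hh'.
Qed.

Lemma mmap_mvar (f : {rmorphism R -> S}) (h : 'I_n -> S) (h' : nat -> S) k :
  (k < n)%N -> (forall i : 'I_n, h i = h' i) -> mmap f h (mvar R n k) = h' k.
Proof.
by move=> lt_k hh'; rewrite /mvar insubT mmapX mmap1U hh'.
Qed.

End Mmap.

Lemma map_mvar n (R S : comNzRingType) (f : {rmorphism R -> S}) k :
  map_mpoly f (mvar R n k) = mvar S n k.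
Proof.
rewrite /mvar; case: insubP => [i _ _|_]; last by rewrite raddf0.
by rewrite map_mpolyX.
Qed.

Section Substitution.
Variables (n n' : nat).

(** This links the truncated sum in [subst] to honest substitution in a polynomial: as the [t i]
    have no constant term, monomials of degree at least [B] cannot reach [mu]. *)
Lemma mcoeff_subst (R : comNzRingType) (t : 'I_n -> mpoly n' R) (Q : mpoly n R)
    mu B : (forall i, ord_ge 1 (t i)) -> (mdeg mu < B)%N ->
  mcoeff mu (mmap (@mpolyC n' R) t Q) =
  \sum_(k : bmultinom n B) mcoeff (bmnm k) Q * mcoeff mu (mmap1 t (bmnm k)).
Proof.
move=> t1 lt_B; rewrite /mmap raddf_sum /=.
under eq_bigr do rewrite mcoeffCM.
rewrite [in RHS](mpolyE Q).
under [RHS]eq_bigr do rewrite raddf_sum mulr_suml.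
rewrite exchange_big /=; apply: eq_bigr => m _.
under eq_bigr do rewrite mcoeffZ mcoeffX.
have [lt_m|ge_m] := ltnP (mdeg m) B; last first.
  rewrite (ord_ge_mmap1 t1) ?(leq_trans lt_B) // mulr0 big1 // => k _.
  case: eqP => [E|]; last by rewrite mulr0 mul0r.
  by move: ge_m; rewrite E leqNgt bmdeg.
rewrite (bigD1 (BMultinom lt_m)) //= eqxx mulr1 big1 ?addr0 // => k k_neq.
case: eqP => [E|]; last by rewrite mulr0 mul0r.
by case/eqP: k_neq; apply: val_inj.
Qed.

Variables (R L : comNzRingType) (f : {rmorphism R -> L}).
Variables (w : nat -> L) (Q : nat -> mpoly n L) (e : nat).
Hypothesis Q_ord : forall i d, (e * d <= i)%N -> ord_ge d (Q i).

(** Past [e * (mdeg k).+1] the terms have order larger than the degree of [k]. Below, [e] is 1 for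
    series in [q], and [p] for series in the elementary symmetric functions, since the [i]-th power
    sum has order about [i / p] in them. *)
Lemma sum_family_widen k B : (e * (mdeg k).+1 <= B)%N ->
  \sum_(1 <= i < e * (mdeg k).+1) w i * mcoeff k (Q i) =
  \sum_(1 <= i < B) w i * mcoeff k (Q i).
Proof.
move=> le_B; have [ge1|lt1] := leqP 1 (e * (mdeg k).+1).
  rewrite [RHS](big_cat_nat ge1 le_B) /= [X in _ = _ + X]big1_seq ?addr0 // => i.
  by rewrite mem_index_iota => /andP [_ /andP [le_i _]]; rewrite (Q_ord le_i) ?mulr0.
rewrite [LHS]big_geq ?(ltnW lt1) // big1 // => i _.
by rewrite (@Q_ord i (mdeg k).+1) ?mulr0 // -ltnS (leq_trans lt1).
Qed.

Variables (F : mser n R) (t : 'I_n -> mpoly n' R).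
Hypothesis F_sum : forall k,
  f (F k) = \sum_(1 <= i < e * (mdeg k).+1) w i * mcoeff k (Q i).
Hypothesis t_ord : forall i, ord_ge 1 (t i).

(** Substitution in [F] may be done term by term over [L], even though only the total sum, not the
    single terms, need have coefficients in [R]. For each [mu] everything is finite, so the sums can
    be exchanged. *)
Lemma subst_family mu B : (e * (mdeg mu).+1 <= B)%N ->
  f (subst F t mu) =
  \sum_(1 <= i < B)
    w i * mcoeff mu (mmap (@mpolyC n' L) (fun i => map_mpoly f (t i)) (Q i)).
Proof.
move=> le_B; have ft_ord i : ord_ge 1 (map_mpoly f (t i)).
  apply: ord_ge1P; have := @t_ord i (@mnm0 n').
  by rewrite mcoeff_map_mpoly mdeg0 => ->; rewrite ?raddf0.
rewrite /subst raddf_sum rmorph_sum /=.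
under [RHS]eq_bigr do rewrite (mcoeff_subst _ ft_ord (ltnSn _)) mulr_sumr.
rewrite exchange_big /=; apply: eq_bigr => k _.
rewrite mcoeffZ rmorphM F_sum (@sum_family_widen _ B); last first.
  by apply: leq_trans le_B; rewrite leq_mul2l (bmdeg k) orbT.
rewrite mulr_suml; apply: eq_bigr => i _; rewrite mulrA; congr (_ * _).
rewrite -mcoeff_map_mpoly /mmap1 rmorph_prod; congr mcoeff.
by apply: eq_bigr => l _; rewrite rmorphXn.
Qed.

End Substitution.

(** * Congruences modulo [p] *)

Section Rdvd.
Variables (D : comNzRingType) (q : D).

Lemma rdvd0 : rdvd q 0. Proof. by exists 0; rewrite mulr0. Qed.

Lemma rdvdD x y : rdvd q x -> rdvd q y -> rdvd q (x + y).
Proof. by move=> [a ->] [b ->]; exists (a + b); rewrite mulrDr. Qed.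

Lemma rdvdN x : rdvd q x -> rdvd q (- x).
Proof. by move=> [a ->]; exists (- a); rewrite mulrN. Qed.

Lemma rdvdMl x y : rdvd q x -> rdvd q (y * x).
Proof. by move=> [a ->]; exists (y * a); rewrite mulrCA. Qed.

Lemma rdvd_sum (I : Type) (r : seq I) (A : pred I) (F : I -> D) :
  (forall i, A i -> rdvd q (F i)) -> rdvd q (\sum_(i <- r | A i) F i).
Proof. by move=> dF; elim/big_ind: _ => //; [exact: rdvd0|exact: rdvdD]. Qed.

Lemma rdvd_subC x y : rdvd q (x - y) -> rdvd q (y - x).
Proof. by move/rdvdN; rewrite opprB. Qed.

Lemma rdvd_trans y x z : rdvd q (x - y) -> rdvd q (y - z) -> rdvd q (x - z).
Proof. by move=> dxy dyz; rewrite -(subrKA y); apply: rdvdD. Qed.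

Lemma rdvd_subD x y x' y' :
  rdvd q (x - x') -> rdvd q (y - y') -> rdvd q (x + y - (x' + y')).
Proof. by move=> dx dy; rewrite opprD addrACA; apply: rdvdD. Qed.

Lemma rdvd_subM x y x' y' :
  rdvd q (x - x') -> rdvd q (y - y') -> rdvd q (x * y - x' * y').
Proof.
move=> dx dy; apply: (@rdvd_trans (x * y')).
  by rewrite -mulrBr; apply: rdvdMl.
by rewrite -mulrBl mulrC; apply: rdvdMl.
Qed.

Lemma rdvd_subX n x x' : rdvd q (x - x') -> rdvd q (x ^+ n - x' ^+ n).
Proof.
move=> dx; elim: n => [|n IH]; first by rewrite subrr; exact: rdvd0.
by rewrite !exprS; apply: rdvd_subM.
Qed.

End Rdvd.

Section PrimePower.
Variables (D : comNzRingType) (p : nat).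
Hypothesis p_pr : prime p.

Lemma prime_exprD (x y : D) : rdvd p%:R ((x + y) ^+ p - (x ^+ p + y ^+ p)).
Proof.
have p_gt0 := prime_gt0 p_pr.
rewrite exprDn -(prednK p_gt0) big_ord_recr big_ord_recl /= (prednK p_gt0).
rewrite bin0 binn subnn subn0 expr0 mulr1 mulr1n mul1r mulr1n.
have cancel_ends (u v w : D) : u + v + w - (u + w) = v.
  by rewrite opprD addrACA subrr addr0 addrAC subrr add0r.
rewrite cancel_ends.
apply: rdvd_sum => i _.
have /dvdnP [c ->] : (p %| 'C(p, bump 0 i))%N.
  by apply: prime_dvd_bin; rewrite //= /bump leq0n add1n; have := ltn_ord i; lia.
by exists (x ^+ (p - bump 0 i) * y ^+ bump 0 i *+ c); rewrite mulr_natl -mulrnA.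
Qed.

Lemma prime_expr_sum (I : Type) (r : seq I) (A : pred I) (F : I -> D) k :
  rdvd p%:R ((\sum_(i <- r | A i) F i) ^+ (p ^ k) -
             \sum_(i <- r | A i) F i ^+ (p ^ k)).
Proof.
have pk_gt0 l : (0 < p ^ l)%N by rewrite expn_gt0 prime_gt0.
have exprDpk x y : rdvd p%:R ((x + y) ^+ (p ^ k) - (x ^+ (p ^ k) + y ^+ (p ^ k)) : D).
  elim: k => [|k IH]; first by rewrite !expr1 subrr; exact: rdvd0.
  rewrite expnSr !exprM; apply: rdvd_trans (rdvd_subX p IH) _.
  exact: prime_exprD.
elim: r => [|i r IH].
  by rewrite !big_nil expr0n gtn_eqF // subrr; exact: rdvd0.
rewrite !big_cons; case: (A i) => //; apply: rdvd_trans (exprDpk _ _) _.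
by apply: rdvd_subD => //; rewrite subrr; exact: rdvd0.
Qed.

End PrimePower.

(** * Power sums of indeterminates and the Frobenius congruence *)

Section ElemSym.
Variables (p : nat).

(** The values of [mesym] in an arbitrary ring, in a form on which ring morphisms act by
    composition. *)
Definition esymf (D : comNzRingType) (x : 'I_p -> D) (k : nat) : D :=
  \sum_(h : {set 'I_p} | #|h| == k) \prod_(i in h) x i.

Lemma mmap_mesym (R D : comNzRingType) (f : {rmorphism R -> D})
  (x : 'I_p -> D) k : mmap f x (mesym p R k) = esymf x k.
Proof.
rewrite /mesym /esymf rmorph_sum; apply: eq_bigr => h _.
by rewrite rmorph_prod; apply: eq_bigr => i _; rewrite /= mmapX mmap1U.
Qed.

Lemma rmorph_esymf (D D' : comNzRingType) (f : {rmorphism D -> D'})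
  (x : 'I_p -> D) k : f (esymf x k) = esymf (f \o x) k.
Proof.
rewrite /esymf rmorph_sum; apply: eq_bigr => h _.
by rewrite rmorph_prod.
Qed.

(** The Vandermonde argument needs distinct elements of a domain; it is applied to indeterminates
    over the integers, and the identity is then specialized to [x]. *)
Lemma newton_esymf (D : comNzRingType) (x : 'I_p -> D) n :
  newton p (fun j => esymf x j.+1) n = \sum_(i < p) x i ^+ n.
Proof.
pose X := [tuple mpolyX int (@mnm1 p i) | i < p].
have X_inj : injective (tnth X).
  move=> i j; rewrite !tnth_mktuple => /(congr1 (mcoeff (mnm1 i))).
  rewrite !mcoeffXU eqxx; case: eqP => // _ /eqP; by rewrite oner_eq0.
have := congr1 (mmap intr x) (newton_esym_at X_inj n).
rewrite map_newton rmorph_sum /= => E.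
rewrite -[RHS](_ : \sum_(i < p) mmap intr x (tnth X i ^+ n) = _).
  rewrite -E; apply: eq_newton => j _; rewrite /= /esym_at /meval mmap_mesym.
  rewrite rmorph_esymf; apply: eq_bigr => h _; apply: eq_bigr => i _.
  by rewrite /= tnth_mktuple mmapX mmap1U.
by apply: eq_bigr => i _; rewrite rmorphXn /= tnth_mktuple mmapX mmap1U.
Qed.

End ElemSym.

Section Unramified.
Variables (p : nat) (R : idomainType).
Hypothesis p_pr : prime p.
Hypothesis R_Rp : is_Rp p R.

Lemma p_neq0 : p%:R != 0 :> R. Proof. by case: R_Rp. Qed.

(** A non-unit [m] would be divisible by [p] in [R]; a Bezout relation between [m] and [p] would
    then make [p] a unit. *)
Lemma natr_unit m : ~~ (p %| m)%N -> m%:R \is a @GRing.unit R.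
Proof.
case: R_Rp => _ _ unitP _ _ ndvd; apply/unitP => -[y Ey].
have m_gt0 : (0 < m)%N by case: m ndvd {Ey} => //; rewrite dvdn0.
have cop : coprime m p by rewrite coprime_sym prime_coprime.
have [[u v] /= Euv] := coprimeP p m_gt0 cop.
have E1 : p%:R * (y * u%:R - v%:R) = 1 :> R.
  rewrite mulrBr mulrA -Ey -!natrM -natrB; first by rewrite mulnC (mulnC p) Euv.
  by move: Euv; lia.
have : (p%:R : R) \is a GRing.unit.
  by apply/unitrPr; exists (y * u%:R - v%:R).
by move/unitP; apply; exists 1; rewrite mulr1.
Qed.

Lemma natr_neq0 n : (0 < n)%N -> n%:R != 0 :> R.
Proof.
move=> n_gt0; have [m ndvd ->] := pfactor_coprime p_pr n_gt0.
rewrite natrM natrX mulf_neq0 ?expf_neq0 ?p_neq0 //.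
apply: contraTneq (natr_unit (m := m) _) => [->|]; first by rewrite unitr0.
by rewrite -prime_coprime.
Qed.

(** The [p]-adic valuation of [k + 1] is at most [k], and its prime-to-[p] part is a unit. This
    supplies the hypothesis [p_div] of the congruences above. *)
Lemma expr_p_div k : exists z : R, p%:R ^+ k = k.+1%:R * z.
Proof.
have [m cop Ek] := pfactor_coprime p_pr (ltn0Sn k).
have m_unit : m%:R \is a @GRing.unit R by apply: natr_unit; rewrite -prime_coprime.
set v := logn p k.+1 in Ek.
have le_v : (v <= k)%N.
  have := ltn_logl p (ltn0Sn k); rewrite ltnS; exact.
exists (m%:R^-1 * p%:R ^+ (k - v)).
by rewrite Ek natrM natrX mulrACA mulrC mulrV // mulr1 -exprD subnKC.
Qed.

Lemma mpoly_expr_p_div n k : exists z : mpoly n R, p%:R ^+ k = k.+1%:R * z.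
Proof.
have [z Ez] := expr_p_div k; exists (mpolyC n z).
by rewrite -!(rmorph_nat (@mpolyC n R)) -rmorphXn -rmorphM Ez.
Qed.

Lemma mpoly_natr_neq0 n k : (0 < k)%N -> k%:R != 0 :> mpoly n R.
Proof. by move=> k_gt0; rewrite -(rmorph_nat (@mpolyC n R)) mpolyC_eq0 natr_neq0. Qed.

(* In terms of roots [x_i], both [s_j (x) ^ q] and [s_j (x ^ q)] give the same
   power sums up to [p n]; since symmetric polynomials are uniquely polynomials
   in the [s_j], the congruence descends. *)
Lemma newton_Frobenius_generic k n : (0 < n)%N ->
  rdvd (p%:R * n%:R) (newton p (fun j => mvar R p j ^+ (p ^ k)) n
                      - newton p (fun j => mvar R p j) (p ^ k * n)).
Proof.
move=> n_gt0; set W := _ - _.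
pose S := [tuple mesym p R i.+1 | i < p].
pose X (i : 'I_p) := mpolyX R (mnm1 i).
have SE j : (j < p)%N -> comp_mpoly S (mvar R p j) = esymf X j.+1.
  move=> lt_j; rewrite /comp_mpoly (@mmap_mvar _ _ _ _ _ (fun j => mesym p R j.+1)) //.
  by move=> i; rewrite tnth_mktuple.
have WS : comp_mpoly S W = newton p (fun j => esymf X j.+1 ^+ (p ^ k)) n
                           - newton p (fun j => esymf X j.+1) (p ^ k * n).
  rewrite raddfB /=; congr (_ - _); rewrite map_newton; apply: eq_newton => j lt_j /=.
    by rewrite rmorphXn /= SE.
  exact: SE.
have [y Ey] : rdvd (p%:R * n%:R) (comp_mpoly S W).
  rewrite WS newton_esymf.
  under [X in _ - X]eq_bigr do rewrite exprM.
  rewrite -(newton_esymf (fun i => X i ^+ (p ^ k))).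
  have esymfX j : exists u, esymf X j.+1 ^+ (p ^ k) =
      esymf (fun i => X i ^+ (p ^ k)) j.+1 + p%:R * u.
    have [u Eu] := prime_expr_sum p_pr (index_enum _)
      (fun h : {set 'I_p} => #|h| == j.+1) (fun h => \prod_(i in h) X i) k.
    exists u; rewrite -Eu /esymf; under [X in _ = X + _]eq_bigr do rewrite prodrXl.
    by rewrite addrC subrK.
  have [u Eu] := choice esymfX.
  by apply: (newton_congr (@mpoly_expr_p_div p) n (u := u)) => j _; exact: Eu.
have pn_neq0 : p%:R * n%:R != 0 :> mpoly p R.
  by apply: mulf_neq0; apply: mpoly_natr_neq0 => //; apply: prime_gt0.
(* The product [p n y] is symmetric, and [p n] can be cancelled in the polynomial ring. *)
have y_sym : y \is symmetric.
  apply/issymP => s; apply: (mulfI pn_neq0); rewrite -Ey.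
  have /issymP/(_ s) : comp_mpoly S W \is symmetric.
    by apply: mcomp_sym => i; rewrite -tnth_nth tnth_mktuple mesym_sym.
  by rewrite {1}Ey -natrM !mulr_natl raddfMn.
(* Writing [y] as [t] evaluated at the elementary symmetric polynomials, their algebraic
   independence gives [W = p n t]. *)
have [t [Et _]] := sym_fundamental y_sym.
exists t; apply: msym_fundamental_un.
by rewrite -/S rmorphM Ey -Et -!natrM rmorph_nat.
Qed.

Lemma newton_Frobenius m (s : nat -> mpoly m R) k n : (0 < n)%N ->
  rdvd (p%:R * n%:R) (newton p (fun j => s j ^+ (p ^ k)) n
                      - newton p s (p ^ k * n)).
Proof.
move=> n_gt0; have [y Ey] := newton_Frobenius_generic k n_gt0.
pose g := mmap (@mpolyC m R) (fun i : 'I_p => s i).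
have gE j : (j < p)%N -> g (mvar R p j) = s j.
  by move=> lt_j; rewrite /g (@mmap_mvar _ _ _ _ _ s).
exists (g y).
have -> : newton p s (p ^ k * n) = g (newton p (fun j => mvar R p j) (p ^ k * n)).
  by rewrite /g map_newton; apply: eq_newton => j /gE.
have -> : newton p (fun j => s j ^+ (p ^ k)) n =
          g (newton p (fun j => mvar R p j ^+ (p ^ k)) n).
  rewrite /g map_newton; apply: eq_newton => j /gE {1}<-.
  by rewrite /g /= rmorphXn.
by rewrite /g -rmorphB Ey !rmorphM !rmorph_nat.
Qed.

End Unramified.

(** * Frobenius lifts *)

Section DeltaRing.
Variables (p : nat) (D : comNzRingType) (phi : {rmorphism D -> D}).
Hypothesis p_torsion_free : forall x y : D, p%:R * x = p%:R * y -> x = y.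
Hypothesis phi_lift : Frobenius_lift p phi.
Local Notation del := (Defs.delta p phi).

Lemma phi_delta x : phi x = x ^+ p + p%:R * del x.
Proof.
have := @xgetPex _ 0 [set y | phi x - x ^+ p = p%:R * y] (phi_lift x).
by rewrite /= /Defs.delta /Defs.divp => <-; rewrite addrC subrK.
Qed.

Lemma delta_unique x y : phi x = x ^+ p + p%:R * y -> del x = y.
Proof. by rewrite phi_delta => /addrI /p_torsion_free. Qed.

End DeltaRing.

(* [phi x] and [phi (phi x)] in terms of [T 0 = x], [T 1 = delta x],
   [T 2 = delta (delta x)]. *)
Definition ghost1 p (D : comNzRingType) (T : nat -> D) : D :=
  T 0%N ^+ p + p%:R * T 1%N.

Definition ghost2 p (D : comNzRingType) (T : nat -> D) : D :=
  (T 0%N ^+ p + p%:R * T 1%N) ^+ p + p%:R * T 1%N ^+ p + p%:R ^+ 2 * T 2%N.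

Lemma rmorph_ghost1 p (D D' : comNzRingType) (f : {rmorphism D -> D'}) T :
  f (ghost1 p T) = ghost1 p (f \o T).
Proof. by rewrite /ghost1 rmorphD rmorphM rmorphXn rmorph_nat. Qed.

Lemma rmorph_ghost2 p (D D' : comNzRingType) (f : {rmorphism D -> D'}) T :
  f (ghost2 p T) = ghost2 p (f \o T).
Proof.
by rewrite /ghost2 !(rmorphD, rmorphM, rmorphXn) /= !rmorph_nat.
Qed.

Lemma eq_ghost1 p (D : comNzRingType) (T T' : nat -> D) :
  (forall k, (k < 3)%N -> T k = T' k) -> ghost1 p T = ghost1 p T'.
Proof. by move=> TT'; rewrite /ghost1 !TT'. Qed.

Lemma eq_ghost2 p (D : comNzRingType) (T T' : nat -> D) :
  (forall k, (k < 3)%N -> T k = T' k) -> ghost2 p T = ghost2 p T'.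
Proof. by move=> TT'; rewrite /ghost2 !TT'. Qed.

Section Ghost.
Variables (p : nat) (D : comNzRingType) (phi : {rmorphism D -> D}).
Hypothesis phi_lift : Frobenius_lift p phi.
Local Notation del := (Defs.delta p phi).

Lemma phi_ghost1 x : phi x = ghost1 p (fun k => iter k del x).
Proof. exact: phi_delta. Qed.

Lemma phi_ghost2 x : phi (phi x) = ghost2 p (fun k => iter k del x).
Proof.
rewrite (phi_delta phi_lift x) rmorphD rmorphM rmorphXn rmorph_nat /=.
rewrite !(phi_delta phi_lift x) (phi_delta phi_lift (del x)) /ghost2 /=.
by rewrite mulrDr mulrA -expr2 addrA.
Qed.

End Ghost.

Lemma ghost1_congr p (D : comNzRingType) (T : nat -> D) :
  exists u, ghost1 p T = T 0%N ^+ (p ^ 1) + p%:R * u.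
Proof. by exists (T 1%N); rewrite expn1. Qed.

Lemma ghost2_congr p (D : comNzRingType) (T : nat -> D) :
  exists u, ghost2 p T = T 0%N ^+ (p ^ 2) + p%:R * u.
Proof.
have [u Eu] : rdvd p%:R ((T 0%N ^+ p + p%:R * T 1%N) ^+ p - (T 0%N ^+ p) ^+ p).
  by apply: rdvd_subX; exists (T 1%N); rewrite addrAC subrr add0r.
exists (u + T 1%N ^+ p + p%:R * T 2%N).
rewrite /ghost2 (canRL (subrK _) Eu) -exprM mulnn !mulrDr expr2 !mulrA.
by rewrite [_ * u + _]addrC -!addrA.
Qed.

Section PhiPoly.
Variables (p r m : nat) (R : idomainType) (phi : {rmorphism R -> R}).
Hypotheses (p_pr : prime p) (R_Rp : is_Rp p R) (phi_lift : Frobenius_lift p phi).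
Local Notation M := (mpoly (r.+1 * m) R).
Local Notation PHI := (@phi_poly p R phi r m).
Local Notation DEL := (@delta_poly p R phi r m).

HB.instance Definition _ := GRing.RMorphism.copy PHI
  (mmap (@mpolyC (r.+1 * m) R \o phi)
    (fun k => mvar R (r.+1 * m) k ^+ p + p%:R * mvar R (r.+1 * m) (k + m))).

Lemma mpoly_p_torsion_free n (x y : mpoly n R) : p%:R * x = p%:R * y -> x = y.
Proof. by apply: mulfI; apply: (mpoly_natr_neq0 p_pr R_Rp); apply: prime_gt0. Qed.

Lemma phi_mvar k : (k < r.+1 * m)%N ->
  PHI (mvar R _ k) = mvar R _ k ^+ p + p%:R * mvar R _ (k + m).
Proof.
move=> lt_k; rewrite /phi_poly.
by rewrite (@mmap_mvar _ _ _ (@mpolyC (r.+1 * m) R \o phi) _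
  (fun k => mvar R (r.+1 * m) k ^+ p + p%:R * mvar R (r.+1 * m) (k + m))).
Qed.

(** The congruence is stable under products, and under sums because raising to the power [p] is
    additive modulo [p]; it remains to check constants and variables. *)
Lemma phi_poly_lift : Frobenius_lift p PHI.
Proof.
have frobM (P Q : M) : rdvd p%:R (PHI P - P ^+ p) -> rdvd p%:R (PHI Q - Q ^+ p) ->
    rdvd p%:R (PHI (P * Q) - (P * Q) ^+ p).
  by move=> dP dQ; rewrite rmorphM exprMn; apply: rdvd_subM.
elim/mpolyind => [|c k P _ _ IH].
  by rewrite rmorph0 expr0n gtn_eqF ?prime_gt0 // subrr; exact: rdvd0.
rewrite rmorphD; apply: rdvd_trans (rdvd_subC (prime_exprD p_pr _ _)).
apply: rdvd_subD IH; rewrite -mul_mpolyC; apply: (frobM).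
  have [y Ey] := phi_lift c; exists (mpolyC _ y).
  have -> : PHI (mpolyC _ c) = mpolyC _ (phi c).
    exact: (mmapC _ (@mpolyC (r.+1 * m) R \o phi)).
  by rewrite -rmorphXn -rmorphB Ey rmorphM /= rmorph_nat.
rewrite mpolyXE_id; elim/big_ind: _ => [|P' Q'|i _]; last 2 first.
- exact: (frobM).
- elim: (k i) => [|e IHe]; first by rewrite rmorph1 expr1n subrr; exact: rdvd0.
  rewrite exprS; apply: (frobM) => //.
  have -> : mpolyX R (mnm1 i) = mvar R _ i by rewrite /mvar valK.
  by rewrite phi_mvar // addrAC subrr add0r; eexists.
by rewrite rmorph1 expr1n subrr; exact: rdvd0.
Qed.

Lemma delta_mvar k : (k < r.+1 * m)%N -> DEL (mvar R _ k) = mvar R _ (k + m).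
Proof.
move=> lt_k; apply: delta_unique (phi_mvar lt_k).
- exact: mpoly_p_torsion_free.
- exact: phi_poly_lift.
Qed.

(** Each [delta] shifts the index by [m]. The bound on [j + k] keeps within the range where
    [phi_poly] is the true [phi]. *)
Lemma delta_qvar i j k : (i < m)%N -> (j + k <= r)%N ->
  iter k DEL (qvar R r m i j) = qvar R r m i (j + k).
Proof.
move=> lt_i; elim: k => [|k IH] le_r; first by rewrite addn0.
rewrite iterS IH; last by rewrite (leq_trans _ le_r) // addnS.
rewrite /qvar delta_mvar; first by congr (mvar R _ _); lia.
have : (j + k < r)%N by rewrite -addnS.
rewrite mulSn; nia.
Qed.

(** In [phi P = P ^ p + p delta P] the constant terms of [phi P] and [P ^ p] vanish, and [p] is not
    a zero divisor. *)
Lemma ord_ge_delta P : ord_ge 1 P -> ord_ge 1 (DEL P).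
Proof.
move=> P1.
have phiP : ord_ge 1 (PHI P).
  apply: ord_ge_mmap => [i|]; last exact: P1.
  apply: ord_geD; last by apply: ord_geMr; exact: ord_ge_mvar.
  apply: ord_geW (@ord_geX _ _ 1 p _ (@ord_ge_mvar _ _ _)).
  by rewrite mul1n prime_gt0.
have Pp : ord_ge 1 (P ^+ p).
  by apply: ord_geW (@ord_geX _ _ 1 p _ P1); rewrite mul1n prime_gt0.
move=> k lt_k; have := congr1 (mcoeff k) (phi_delta phi_poly_lift P).
rewrite phiP // mcoeffD Pp // add0r mulr_natl mcoeffMn -mulr_natl => /esym/eqP.
by rewrite mulf_eq0 (negPf (p_neq0 R_Rp)) => /eqP.
Qed.

End PhiPoly.

(** * Coefficients in the fraction field *)

Section RatrChar0.
Variable L : fieldType.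
Hypothesis char0 : forall n, (0 < n)%N -> n%:R != 0 :> L.

Lemma intr_neq0_char0 (z : int) : z != 0 -> z%:~R != 0 :> L.
Proof.
case: z => n; last by move=> _; rewrite oppr_eq0; exact: char0.
by rewrite -pmulrn => n_neq0; apply: char0; rewrite lt0n.
Qed.

(** The field [L] is only assumed to have characteristic 0 and carries no order. Computing [ratr]
    from any fraction, reduced or not, makes its additivity and multiplicativity direct. *)
Lemma ratr_char0E (x : rat) (n d : int) :
  d != 0 -> x * d%:~R = n%:~R -> ratr x = n%:~R / d%:~R :> L.
Proof.
move=> d_neq0 xd; apply/eqP; rewrite /ratr eqr_div ?intr_neq0_char0 ?denq_neq0 //.
rewrite -!intrM; apply/eqP; congr (_%:~R); apply: (@intr_inj rat).
by rewrite !rmorphM /= -xd numqE mulrAC.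
Qed.

Lemma ratr_char0D (x y : rat) : ratr (x + y) = ratr x + ratr y :> L.
Proof.
have dx := intr_neq0_char0 (denq_neq0 x); have dy := intr_neq0_char0 (denq_neq0 y).
rewrite (@ratr_char0E _ (numq x * denq y + numq y * denq x) (denq x * denq y)).
- by rewrite [in RHS]/ratr addf_div // rmorphD !rmorphM.
- by rewrite mulf_neq0 ?denq_neq0.
- by rewrite rmorphD !rmorphM /= !numqE mulrDl !mulrA [y * _ * _]mulrAC.
Qed.

Lemma ratr_char0M (x y : rat) : ratr (x * y) = ratr x * ratr y :> L.
Proof.
rewrite (@ratr_char0E _ (numq x * numq y) (denq x * denq y)).
- by rewrite [in RHS]/ratr mulf_div !rmorphM.
- by rewrite mulf_neq0 ?denq_neq0.
- by rewrite !rmorphM /= !numqE mulrACA.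
Qed.

End RatrChar0.

Section Integral.
Variable R : idomainType.
Local Notation L := {fraction R}.

Definition integral_in (x : L) : Prop := exists y : R, tofrac y = x.

Lemma integral_inM x y : integral_in x -> integral_in y -> integral_in (x * y).
Proof. by move=> [u <-] [v <-]; exists (u * v); rewrite rmorphM. Qed.

Lemma integral_inD x y : integral_in x -> integral_in y -> integral_in (x + y).
Proof. by move=> [u <-] [v <-]; exists (u + v); rewrite rmorphD. Qed.

Lemma integral_inN x : integral_in x -> integral_in (- x).
Proof. by move=> [u <-]; exists (- u); rewrite rmorphN. Qed.

Lemma integral_in_nat n : integral_in n%:R.
Proof. by exists n%:R; rewrite rmorph_nat. Qed.

Lemma integral_in_sum (I : Type) (r : seq I) (A : pred I) (F : I -> L) :
  (forall i, A i -> integral_in (F i)) -> integral_in (\sum_(i <- r | A i) F i).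
Proof.
move=> intF; elim/big_ind: _ => //; first exact: (integral_in_nat 0).
exact: integral_inD.
Qed.

Lemma integral_inV (x : R) : x \is a GRing.unit -> integral_in (tofrac x)^-1.
Proof.
move=> x_unit; exists x^-1; apply: (mulfI (x := tofrac x)).
  by rewrite tofrac_eq0; apply: contraTneq x_unit => ->; rewrite unitr0.
rewrite -rmorphM divrr // rmorph1 divff // tofrac_eq0.
by apply: contraTneq x_unit => ->; rewrite unitr0.
Qed.

End Integral.

Section PureCoefficient.
Variables (n : nat) (L : comNzRingType) (c : 'I_n).

(** Setting all variables but one to 0 is a ring morphism, unlike taking a coefficient; powers can
    be simplified before the coefficient of a pure power is read off. *)
Definition pure_poly : mpoly n L -> {poly L} :=
  mmap (@polyC L) (fun i => if i == c then 'X else 0).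

HB.instance Definition _ := GRing.RMorphism.copy pure_poly
  (mmap (@polyC L) (fun i => if i == c then 'X else 0)).

Lemma coef_pure_poly m (k0 : multinom n) (P : mpoly n L) :
  (forall i, k0 i = if i == c then m else 0%N) ->
  (pure_poly P)`_m = mcoeff k0 P.
Proof.
move=> k0E; rewrite /pure_poly /mmap coef_sum [in RHS](mpolyE P) raddf_sum /=.
apply: eq_bigr => k _; rewrite coefCM mcoeffZ mcoeffX; congr (_ * _).
have -> : mmap1 (fun i => if i == c then 'X else 0) k =
          if [forall i, (i != c) ==> (k i == 0%N)] then 'X^(k c) else 0 :> {poly L}.
  rewrite /mmap1 (bigD1 c) //= eqxx; case: forallP => [k0'|nk].
    rewrite big1 ?mulr1 // => i i_neq.
    by have := k0' i; rewrite i_neq (negPf i_neq) => /eqP ->; rewrite expr0.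
  move/existsNP: nk => [i /negP]; rewrite negb_imply => /andP [i_neq ki].
  rewrite (bigD1 i) //= (negPf i_neq).
  by rewrite expr0n (negPf ki) mul0r mulr0.
have [->|k_neq] := eqVneq k k0.
  rewrite ifT; first by rewrite coefXn k0E !eqxx.
  by apply/forallP => i; apply/implyP => i_neq; rewrite k0E (negPf i_neq).
case: forallP => [k0'|]; last by rewrite coef0.
rewrite coefXn; case: eqP => // Em; case/eqP: k_neq; apply/mnmP => i.
rewrite k0E; case: eqVneq => [->//|i_neq].
by have := k0' i; rewrite i_neq => /eqP.
Qed.

End PureCoefficient.

(** The summand sees both [i] and [p i], so one reindexing serves the term coming from [q ^ p] as
    well as the one coming from the last slots. *)
Lemma big_nat_mul (V : nmodType) (p B : nat) (G : nat -> nat -> V) : (0 < p)%N ->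
  \sum_(1 <= i < B) G i (p * i)%N =
  \sum_(1 <= m < p * B | (p %| m)%N) G (m %/ p)%N m.
Proof.
move=> p_gt0; rewrite -[RHS]big_filter.
rewrite [RHS](perm_big [seq (p * i)%N | i <- index_iota 1 B]) /=.
  by rewrite big_map; apply: eq_bigr => i _; rewrite mulKn.
apply: uniq_perm; first by rewrite filter_uniq ?iota_uniq.
  rewrite map_inj_uniq ?iota_uniq // => i j /eqP.
  by rewrite eqn_pmul2l // => /eqP.
move=> m; rewrite mem_filter mem_index_iota; apply/idP/mapP => [ | [k k_in ->] ].
  move=> /andP [/dvdnP [i ->]]; rewrite [(i * p)%N]mulnC ltn_pmul2l // muln_gt0.
  by move=> /andP [/andP [_ i_gt0] lt_i]; exists i; rewrite // mem_index_iota i_gt0.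
move: k_in; rewrite mem_index_iota => /andP [k_gt0 lt_k].
by rewrite dvdn_mulr // ltn_pmul2l // lt_k muln_gt0 p_gt0 k_gt0.
Qed.

(** * The symmetrized series *)

Section Eigen.
Variables (p : nat) (R : idomainType) (phi : {rmorphism R -> R}).
Hypotheses (p_pr : prime p) (p_odd : odd p).
Hypotheses (R_Rp : is_Rp p R) (phi_lift : Frobenius_lift p phi).
Local Notation L := {fraction R}.
Local Notation f := (@tofrac R).
Variables al be ga : L.

Let p_gt0 : (0 < p)%N. Proof. exact: prime_gt0. Qed.

Lemma fraction_natr_neq0 n : (0 < n)%N -> n%:R != 0 :> L.
Proof. by move=> n_gt0; rewrite -(rmorph_nat f) tofrac_eq0 (natr_neq0 p_pr R_Rp). Qed.

(** The scalars [al], [be], [ga] are those of [phi^2], [phi] and the identity: [1/p], [- a_p/p], [1]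
    in case (a), and [0], [1/p], [- u] in case (b). *)
Definition mix n (P2 P1 P0 : mpoly n L) : mpoly n L :=
  al *: P2 + be *: P1 + ga *: P0.

Definition qmix (i : nat) : mpoly (3 * 1) L :=
  mix (ghost2 p (qvar L 2 1 0) ^+ i) (ghost1 p (qvar L 2 1 0) ^+ i)
      (qvar L 2 1 0 0 ^+ i).

(** Here the variable [qvar L 2 p j k] stands for [delta^k S_(j+1)], so the ghost components stand
    for [phi^2] and [phi] of [S_(j+1)]. *)
Definition smix (i : nat) : mpoly (3 * p) L :=
  mix (newton p (fun j => ghost2 p (qvar L 2 p j)) i)
      (newton p (fun j => ghost1 p (qvar L 2 p j)) i)
      (newton p (fun j => qvar L 2 p j 0) i).

Lemma mmap_mix n n' (h : 'I_n -> mpoly n' L) (P2 P1 P0 : mpoly n L) :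
  mmap (@mpolyC n' L) h (mix P2 P1 P0) =
  mix (mmap (@mpolyC n' L) h P2) (mmap (@mpolyC n' L) h P1)
      (mmap (@mpolyC n' L) h P0).
Proof. by rewrite /mix !mmapD !mmapZ !mul_mpolyC. Qed.

Lemma mix_natl n c (P2 P1 P0 : mpoly n L) :
  mix (c%:R * P2) (c%:R * P1) (c%:R * P0) = c%:R *: mix P2 P1 P0.
Proof.
rewrite /mix !mulr_natl scaler_nat !mulrnDl.
by rewrite -!scalerMnr.
Qed.

Lemma mix_sum n m (P2 P1 P0 : 'I_m -> mpoly n L) :
  mix (\sum_i P2 i) (\sum_i P1 i) (\sum_i P0 i) =
  \sum_i mix (P2 i) (P1 i) (P0 i).
Proof. by rewrite /mix !scaler_sumr -!big_split. Qed.

Lemma ord_ge_mix n d (P2 P1 P0 : mpoly n L) :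
  ord_ge d P2 -> ord_ge d P1 -> ord_ge d P0 -> ord_ge d (mix P2 P1 P0).
Proof.
by move=> d2 d1 d0; apply: ord_geD; [apply: ord_geD|]; apply: ord_geZ.
Qed.

Lemma ord_ge_ghost1 n (A : comNzRingType) (T : nat -> mpoly n A) :
  (forall k, ord_ge 1 (T k)) -> ord_ge 1 (ghost1 p T).
Proof.
move=> T1; apply: ord_geD; last exact: ord_geMr.
by apply: ord_geW (@ord_geX _ _ 1 p _ (T1 0%N)); rewrite mul1n.
Qed.

Lemma ord_ge_ghost2 n (A : comNzRingType) (T : nat -> mpoly n A) :
  (forall k, ord_ge 1 (T k)) -> ord_ge 1 (ghost2 p T).
Proof.
move=> T1; have X1 P : ord_ge 1 P -> ord_ge 1 (P ^+ p).
  by move=> P1; apply: ord_geW (@ord_geX _ _ 1 p _ P1); rewrite mul1n.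
apply: ord_geD; last exact: ord_geMr.
by apply: ord_geD; [apply/X1/ord_ge_ghost1|apply: ord_geMr; exact: X1].
Qed.

Lemma ord_ge_qmix i d : (1 * d <= i)%N -> ord_ge d (qmix i).
Proof.
rewrite mul1n => le_d; have X1 (P : mpoly (3 * 1) L) : ord_ge 1 P -> ord_ge d (P ^+ i).
  by move=> P1; apply: ord_geW (@ord_geX _ _ 1 i _ P1); rewrite mul1n.
have q1 k : ord_ge 1 (qvar L 2 1 0 k) by exact: ord_ge_mvar.
by apply: ord_ge_mix; apply: X1 => //; [exact: ord_ge_ghost2|exact: ord_ge_ghost1].
Qed.

Lemma ord_ge_smix i d : (p * d <= i)%N -> ord_ge d (smix i).
Proof.
move=> le_d; have q1 j k : ord_ge 1 (qvar L 2 p j k) by exact: ord_ge_mvar.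
by apply: ord_ge_mix; apply: ord_ge_newton => // j;
  [exact: ord_ge_ghost2|exact: ord_ge_ghost1].
Qed.

Lemma mmap_qvar n' m (h : 'I_(3 * m) -> mpoly n' L) (T : nat -> mpoly n' L) j k :
  (forall l : 'I_(3 * m), h l = T l) -> (j < m)%N -> (k < 3)%N ->
  mmap (@mpolyC n' L) h (qvar L 2 m j k) = T (k * m + j)%N.
Proof.
move=> hT lt_j lt_k; rewrite /qvar (@mmap_mvar _ _ _ _ _ T) //.
by rewrite mulSn addnC; case: k lt_k => [|[|[|k]]] //= _; nia.
Qed.

Lemma mmap_qmix n' (h : 'I_(3 * 1) -> mpoly n' L) (T : nat -> mpoly n' L) i :
  (forall l : 'I_(3 * 1), h l = T l) ->
  mmap (@mpolyC n' L) h (qmix i) =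
  mix (ghost2 p T ^+ i) (ghost1 p T ^+ i) (T 0%N ^+ i).
Proof.
move=> hT; have qT k : (k < 3)%N -> mmap (@mpolyC n' L) h (qvar L 2 1 0 k) = T k.
  by move=> lt_k; rewrite (mmap_qvar hT) // muln1 addn0.
rewrite /qmix mmap_mix !rmorphXn /= rmorph_ghost1 rmorph_ghost2.
by rewrite (eq_ghost1 _ qT) (eq_ghost2 _ qT) qT.
Qed.

Lemma mmap_smix n' (h : 'I_(3 * p) -> mpoly n' L) (T : nat -> nat -> mpoly n' L) i :
  (forall l : 'I_(3 * p), h l = T (l %% p)%N (l %/ p)%N) ->
  mmap (@mpolyC n' L) h (smix i) =
  mix (newton p (fun j => ghost2 p (T j)) i) (newton p (fun j => ghost1 p (T j)) i)
      (newton p (fun j => T j 0%N) i).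
Proof.
move=> hT; have qT j k : (j < p)%N -> (k < 3)%N ->
    mmap (@mpolyC n' L) h (qvar L 2 p j k) = T j k.
  move=> lt_j lt_k; rewrite (mmap_qvar (T := fun l => T (l %% p)%N (l %/ p)%N)) //.
  by rewrite modnMDl divnMDl // modn_small // divn_small // addn0.
rewrite /smix mmap_mix; congr (mix _ _ _); rewrite map_newton;
  apply: eq_newton => j lt_j /=.
- by rewrite rmorph_ghost2; apply: eq_ghost2 => k /(qT j k lt_j).
- by rewrite rmorph_ghost1; apply: eq_ghost1 => k /(qT j k lt_j).
- by rewrite qT.
Qed.

Local Notation DEL m := (@delta_poly p R phi 2 m).
Local Notation PHI m := (@phi_poly p R phi 2 m).

Lemma map_qvar m j k : map_mpoly f (qvar R 2 m j k) = qvar L 2 m j k.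
Proof. exact: map_mvar. Qed.

Lemma elem_symE m j :
  elem_sym R 2 m j = esymf (fun i : 'I_m => qvar R 2 m i 0) j.+1.
Proof. exact: mmap_mesym. Qed.

(** On the [delta^k S_j] the ghost components become [phi^2 S_j] and [phi S_j]. As [newton] has
    integral coefficients it commutes with [phi], which leaves [phi^2] and [phi] of the power sum of
    the [q_i]; these are computed summand by summand. *)
Lemma mmap_smix_delta_sym (h : 'I_(3 * p) -> mpoly (3 * p) R) n :
  (forall l : 'I_(3 * p), h l = iter (l %/ p) (DEL p) (elem_sym R 2 p (l %% p))) ->
  mmap (@mpolyC _ L) (fun l => map_mpoly f (h l)) (smix n) =
  \sum_(i < p) mix (ghost2 p (qvar L 2 p i) ^+ n) (ghost1 p (qvar L 2 p i) ^+ n)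
                   (qvar L 2 p i 0 ^+ n).
Proof.
move=> hE; pose S j := elem_sym R 2 p j.
rewrite (@mmap_smix _ _ (fun j k => map_mpoly f (iter k (DEL p) (S j)))); last first.
  by move=> l; rewrite hE.
have PHI_lift : Frobenius_lift p (PHI p) by exact: phi_poly_lift.
have newtonS : newton p S n = \sum_(i < p) qvar R 2 p i 0 ^+ n.
  rewrite -(newton_esymf (fun i : 'I_p => qvar R 2 p i 0)).
  by apply: eq_newton => j _; exact: elem_symE.
have PHI_psum (x : 'I_p -> mpoly (3 * p) R) :
    PHI p (\sum_(i < p) x i ^+ n) = \sum_(i < p) PHI p (x i) ^+ n.
  rewrite [LHS](rmorph_sum (PHI p)); apply: eq_bigr => i _.
  exact: (rmorphXn (PHI p)).
have map_psum (x : 'I_p -> mpoly (3 * p) R) :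
    map_mpoly f (\sum_(i < p) x i ^+ n) = \sum_(i < p) map_mpoly f (x i) ^+ n.
  by rewrite rmorph_sum; apply: eq_bigr => i _; rewrite rmorphXn.
have q_delta (i : 'I_p) k : (k < 3)%N ->
    map_mpoly f (iter k (DEL p) (qvar R 2 p i 0)) = qvar L 2 p i k.
  move=> lt_k; rewrite (delta_qvar p_pr R_Rp phi_lift) ?ltn_ord ?add0n //.
  exact: map_qvar.
have PHI1 : PHI p (newton p S n) = \sum_(i < p) PHI p (qvar R 2 p i 0) ^+ n.
  by rewrite newtonS; exact: PHI_psum.
have PHI2 : PHI p (PHI p (newton p S n)) =
    \sum_(i < p) PHI p (PHI p (qvar R 2 p i 0)) ^+ n.
  by rewrite PHI1; exact: PHI_psum.
rewrite -mix_sum; congr (mix _ _ _).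
- rewrite (@eq_newton _ _ _ (map_mpoly f \o (PHI p \o (PHI p \o S)))); last first.
    by move=> j _; rewrite /= (phi_ghost2 PHI_lift) rmorph_ghost2.
  rewrite -map_newton -(map_newton (PHI p)) -(map_newton (PHI p)).
  apply: etrans (congr1 (map_mpoly f) PHI2) _; apply: etrans (map_psum _) _.
  apply: eq_bigr => i _; congr (_ ^+ _).
  rewrite (phi_ghost2 PHI_lift) rmorph_ghost2; apply: eq_ghost2 => k lt_k.
  exact: q_delta.
- rewrite (@eq_newton _ _ _ (map_mpoly f \o (PHI p \o S))); last first.
    by move=> j _; rewrite /= (phi_ghost1 PHI_lift) rmorph_ghost1.
  rewrite -map_newton -(map_newton (PHI p)).
  apply: etrans (congr1 (map_mpoly f) PHI1) _; apply: etrans (map_psum _) _.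
  apply: eq_bigr => i _; congr (_ ^+ _).
  rewrite (phi_ghost1 PHI_lift) rmorph_ghost1; apply: eq_ghost1 => k lt_k.
  exact: q_delta.
- rewrite -(map_newton (map_mpoly f)) newtonS.
  apply: etrans (map_psum _) _; apply: eq_bigr => i _.
  by rewrite map_qvar.
Qed.

(** The reason is [phi (q ^ p) = phi (q) ^ p], and likewise for [phi^2]. *)
Lemma mmap_qmix_Vp n :
  mmap (@mpolyC _ L)
    (fun l : 'I_(3 * 1) => map_mpoly f (iter l (DEL 1) (qvar R 2 1 0 0 ^+ p))) (qmix n)
  = qmix (p * n).
Proof.
rewrite (@mmap_qmix _ _ (fun l => map_mpoly f (iter l (DEL 1) (qvar R 2 1 0 0 ^+ p)))) //.
have PHI_lift : Frobenius_lift p (PHI 1) by exact: phi_poly_lift.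
have q_delta k : (k < 3)%N ->
    map_mpoly f (iter k (DEL 1) (qvar R 2 1 0 0)) = qvar L 2 1 0 k.
  by move=> lt_k; rewrite (delta_qvar p_pr R_Rp phi_lift) ?add0n // map_qvar.
have PHIX x : PHI 1 (x ^+ p) = PHI 1 x ^+ p by exact: (rmorphXn (PHI 1)).
have mapX x : map_mpoly f (x ^+ p) = map_mpoly f x ^+ p by exact: rmorphXn.
have G2 x : ghost2 p (fun l => map_mpoly f (iter l (DEL 1) x)) =
    map_mpoly f (PHI 1 (PHI 1 x)).
  by rewrite (phi_ghost2 PHI_lift) rmorph_ghost2.
have G1 x : ghost1 p (fun l => map_mpoly f (iter l (DEL 1) x)) =
    map_mpoly f (PHI 1 x).
  by rewrite (phi_ghost1 PHI_lift) rmorph_ghost1.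
rewrite G2 G1 !PHIX !mapX -G2 -G1 (eq_ghost2 _ q_delta) (eq_ghost1 _ q_delta).
by rewrite map_qvar -!exprM.
Qed.

(** Ghost components of zero slots are zero, so each of the three arguments of [newton] is again
    concentrated in the last slot and [newton_last] applies to it. *)
Lemma mmap_smix_last (h : 'I_(3 * p) -> mpoly (3 * 1) R) n :
  (forall l : 'I_(3 * p),
     h l = if (l %% p == p.-1)%N then qvar R 2 1 0 (l %/ p) else 0) ->
  mmap (@mpolyC _ L) (fun l => map_mpoly f (h l)) (smix n) =
  if (p %| n)%N then p%:R *: qmix (n %/ p) else 0.
Proof.
move=> hE.
rewrite (@mmap_smix _ _ (fun j k => if j == p.-1 then qvar L 2 1 0 k else 0)); last first.
  by move=> l; rewrite hE; case: ifP => _; [exact: map_qvar|exact: raddf0].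
have z1 : ghost1 p (fun=> 0) = 0 :> mpoly (3 * 1) L.
  by rewrite /ghost1 expr0n gtn_eqF // mulr0 addr0.
have z2 : ghost2 p (fun=> 0) = 0 :> mpoly (3 * 1) L.
  by rewrite /ghost2 expr0n gtn_eqF // !mulr0 !addr0 expr0n gtn_eqF.
have E2 : newton p (fun j => ghost2 p (fun k => if j == p.-1 then qvar L 2 1 0 k else 0)) n
    = if (p %| n)%N then p%:R * ghost2 p (qvar L 2 1 0) ^+ (n %/ p) else 0.
  transitivity (newton p (fun j => if j == p.-1 then ghost2 p (qvar L 2 1 0) else 0) n).
    by apply: eq_newton => j _; case: (j == p.-1); last exact: z2.
  exact: newton_last.
have E1 : newton p (fun j => ghost1 p (fun k => if j == p.-1 then qvar L 2 1 0 k else 0)) n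
    = if (p %| n)%N then p%:R * ghost1 p (qvar L 2 1 0) ^+ (n %/ p) else 0.
  transitivity (newton p (fun j => if j == p.-1 then ghost1 p (qvar L 2 1 0) else 0) n).
    by apply: eq_newton => j _; case: (j == p.-1); last exact: z1.
  exact: newton_last.
have E0 := @newton_last (mpoly (3 * 1) L) p n (qvar L 2 1 0 0) p_odd.
rewrite E2 E1 E0; case: (p %| n)%N; first exact: mix_natl.
by rewrite /mix !scaler0 !addr0.
Qed.

End Eigen.

Lemma split_integral_part (K : fieldType) (c i q al be ga n2 n1 n0 y2 y1 : K) :
  i != 0 ->
  c / i * (al * (n2 + q * i * y2) + be * (n1 + q * i * y1) + ga * n0) =
  c / i * (al * n2 + be * n1 + ga * n0) + (c * (q * al) * y2 + c * (q * be) * y1).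
Proof. by move=> i_neq0; field. Qed.

Lemma cancel_mul (K : fieldType) (c q i : K) :
  q != 0 -> c / (q * i) * q = c / i.
Proof. by move=> q_neq0; rewrite invfM mulrA mulrAC divfK. Qed.

(** * Integrality of the symmetrized series, and the action of [T(p)] *)

Section TpEigen.
Variables (p : nat) (R : idomainType) (phi : {rmorphism R -> R}).
Hypotheses (p_pr : prime p) (p_odd : odd p).
Hypotheses (R_Rp : is_Rp p R) (phi_lift : Frobenius_lift p phi).
Local Notation L := {fraction R}.
Local Notation f := (@tofrac R).
Variables (a : nat -> rat) (al be ga : L) (lam : R) (F : mser (3 * 1) R).
Hypothesis hecke_a : forall n, (0 < n)%N ->
  a (p * n)%N + (if (p %| n)%N then p%:R * a (n %/ p)%N else 0) = a p * a n.
Hypotheses (al_int : integral_in (p%:R * al)) (be_int : integral_in (p%:R * be)).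
Hypotheses (ga_neq0 : ga != 0) (gaV_int : integral_in ga^-1).
Hypothesis lamE : f lam = ratr (a p).
Local Notation w n := (ratr (a n) / n%:R : L).
Local Notation Qp := (qmix p al be ga).
Local Notation Sp := (smix p al be ga).
Hypothesis F_sum : forall k,
  f (F k) = \sum_(1 <= i < 1 * (mdeg k).+1) w i * mcoeff k (Qp i).

Let p_gt0 : (0 < p)%N. Proof. exact: prime_gt0. Qed.
Let natL_neq0 n : (0 < n)%N -> n%:R != 0 :> L.
Proof. exact: (fraction_natr_neq0 p_pr R_Rp). Qed.

Lemma hecke_ratr n : (0 < n)%N ->
  ratr (a (p * n)%N) + (if (p %| n)%N then p%:R * ratr (a (n %/ p)%N) else 0)
  = f lam * ratr (a n) :> L.
Proof.
move=> n_gt0; rewrite lamE -(ratr_char0M natL_neq0) -hecke_a //.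
rewrite (ratr_char0D natL_neq0); congr (_ + _); case: ifP => _.
  by rewrite (ratr_char0M natL_neq0) ratr_nat.
by rewrite -(mulr0n (1 : rat)) ratr_nat.
Qed.

(** At [q' = q'' = 0], [phi q] and [phi^2 q] reduce to [q ^ p] and [q ^ (p ^ 2)]. *)
Lemma mcoeff_qmix_q i m :
  mcoeff (mon3 m 0 0) (Qp i) =
  al * (p ^ 2 * i == m)%N%:R + be * (p * i == m)%N%:R + ga * (i == m)%N%:R.
Proof.
have c0P : (0 < 3 * 1)%N by [].
pose c0 := Ordinal c0P.
rewrite -(@coef_pure_poly _ _ c0 m); last first.
  by move=> k; rewrite /mon3 multinomE tnth_mktuple; case: k => [[|[|[|k]]]].
have pureq k : pure_poly c0 (qvar L 2 1 0 k) = if k == 0%N then 'X else 0.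
  rewrite /qvar /mvar; case: insubP => [i0 _ Ei0|].
    rewrite /pure_poly mmapX mmap1U; congr (if _ then _ else _).
    by rewrite -val_eqE /= Ei0 muln1 addn0.
  by case: k => [|k] //= _; rewrite rmorph0.
have pure1 : pure_poly c0 (ghost1 p (qvar L 2 1 0)) = 'X ^+ p.
  by rewrite rmorph_ghost1 /ghost1 /= !pureq /= mulr0 addr0.
have pure2 : pure_poly c0 (ghost2 p (qvar L 2 1 0)) = 'X ^+ (p ^ 2).
  rewrite rmorph_ghost2 /ghost2 /= !pureq /= !mulr0 !addr0 expr0n gtn_eqF //.
  by rewrite mulr0 addr0 -exprM mulnn.
have pureZ c P : pure_poly c0 (c *: P) = c%:P * pure_poly c0 P by exact: mmapZ.
have pureX P e : pure_poly c0 (P ^+ e) = pure_poly c0 P ^+ e by exact: rmorphXn.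
have pure_mix P2 P1 P0 : pure_poly c0 (mix al be ga P2 P1 P0) =
    al%:P * pure_poly c0 P2 + be%:P * pure_poly c0 P1 + ga%:P * pure_poly c0 P0.
  by rewrite /mix !rmorphD /= !pureZ.
rewrite pure_mix !pureX pure1 pure2 pureq /= -!exprM !coefD !coefCM !coefXn.
by rewrite ![(m == _)]eq_sym.
Qed.

Lemma mdeg_mon3 x y z : mdeg (mon3 x y z) = (x + y + z)%N.
Proof.
rewrite mdegE !big_ord_recl big_ord0 addn0 addnA.
by rewrite /mon3 !multinomE !tnth_mktuple.
Qed.

Lemma F_q m B : (m < B)%N ->
  f (F (mon3 m 0 0)) = \sum_(1 <= i < B) w i *
    (al * (p ^ 2 * i == m)%N%:R + be * (p * i == m)%N%:R + ga * (i == m)%N%:R).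
Proof.
move=> lt_m; rewrite F_sum.
rewrite (@sum_family_widen _ _ (fun i => w i) _ _ (ord_ge_qmix p_pr al be ga) _ B).
  by apply: eq_bigr => i _; rewrite mcoeff_qmix_q.
by rewrite mdeg_mon3 !addn0 mul1n.
Qed.

(** Strong induction: for [p] dividing [n] the Hecke relation expresses [a_n] by earlier terms.
    Otherwise the coefficient of [q ^ n] in [F] is [ga a_n / n], because the [phi] parts only
    involve exponents divisible by [p]. *)
Lemma a_integral n : (0 < n)%N -> integral_in (ratr (a n) : L).
Proof.
elim/ltn_ind: n => n IH n_gt0; have [/dvdnP [n' En]|ndvd] := boolP (p %| n)%N.
  have n'_gt0 : (0 < n')%N by move: n_gt0; rewrite En; case: n' {En}.
  have lt_n' : (n' < n)%N by rewrite En ltn_Pmulr // prime_gt1.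
  have -> : ratr (a n) = f lam * ratr (a n') -
      (if (p %| n')%N then p%:R * ratr (a (n' %/ p)%N) else 0).
    by rewrite -hecke_ratr // addrK mulnC -En.
  apply: integral_inD.
    by apply: integral_inM; [exists lam|exact: IH].
  apply: integral_inN; case: ifP => [dvd'|_]; last exact: (integral_in_nat _ 0).
  apply: integral_inM; first exact: integral_in_nat.
  apply: IH; last by rewrite divn_gt0 // dvdn_leq.
  exact: leq_ltn_trans (leq_div _ _) lt_n'.
have : integral_in (w n * ga).
  exists (F (mon3 n 0 0)); rewrite (F_q (ltnSn n)).
  rewrite (big_cat_nat (n := n)) //= big_nat1 eqxx mulr1.
  rewrite [X in X + _]big_nat big1 ?add0r => [|i /andP [i_gt0 lt_i]].
    have nn q : (p %| q)%N -> (q * n == n)%N = false.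
      move=> dvd_q; apply/eqP => E; case/negP: ndvd; rewrite -E.
      exact: dvdn_mulr.
    by rewrite !nn ?dvdn_exp // !mulr0 !add0r.
  have ni q : (p %| q)%N -> (q * i == n)%N = false.
    move=> dvd_q; apply/eqP => E; case/negP: ndvd; rewrite -E.
    exact: dvdn_mulr.
  by rewrite !ni ?dvdn_exp // (ltn_eqF lt_i) !mulr0 !addr0 mulr0.
move=> wn_int; have -> : ratr (a n) = n%:R * (w n * ga * ga^-1).
  by rewrite mulfK // mulrC divfK // natL_neq0.
by apply: integral_inM; [exact: integral_in_nat|exact: integral_inM].
Qed.

Local Notation nu s n := (@newton (mpoly (3 * p) R) p s n).

(** Modulo [p] the ghost component is the [p ^ 2]-th power of its first slot. [newton_congr] turns
    this into a congruence modulo [p n], and [newton_Frobenius] moves the exponent from the slots to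
    the index. *)
Lemma newton_ghost2 n : (0 < n)%N -> exists y,
  nu (fun j => ghost2 p (qvar R 2 p j)) n =
  nu (fun j => qvar R 2 p j 0) (p ^ 2 * n) + p%:R * n%:R * y.
Proof.
move=> n_gt0.
have [u Eu] := choice (fun j => ghost2_congr p (qvar R 2 p j)).
have [y Ey] := newton_congr (mpoly_expr_p_div p_pr R_Rp (3 * p)) n
  (fun j (_ : (j < p)%N) => Eu j).
have [z Ez] := newton_Frobenius p_pr R_Rp (fun j => qvar R 2 p j 0) 2 n_gt0.
by exists (y + z); rewrite mulrDr -Ey -Ez subrKA addrC subrK.
Qed.

Lemma newton_ghost1 n : (0 < n)%N -> exists y,
  nu (fun j => ghost1 p (qvar R 2 p j)) n =
  nu (fun j => qvar R 2 p j 0) (p * n) + p%:R * n%:R * y.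
Proof.
move=> n_gt0.
have [u Eu] := choice (fun j => ghost1_congr p (qvar R 2 p j)).
have [y Ey] := newton_congr (mpoly_expr_p_div p_pr R_Rp (3 * p)) n
  (fun j (_ : (j < p)%N) => Eu j).
have [z Ez] := newton_Frobenius p_pr R_Rp (fun j => qvar R 2 p j 0) 1 n_gt0.
by exists (y + z); rewrite mulrDr -Ey -Ez expn1 subrKA addrC subrK.
Qed.

Lemma map_mpoly_newton (T : nat -> mpoly (3 * p) R) (T' : nat -> mpoly (3 * p) L) n :
  (forall j, map_mpoly f (T j) = T' j) ->
  map_mpoly f (newton p T n) = newton p T' n.
Proof. by move=> TT'; rewrite map_newton; apply: eq_newton => j _; exact: TT'. Qed.

Lemma mcoeff_mix n k (P2 P1 P0 : mpoly n L) :
  mcoeff k (mix al be ga P2 P1 P0) =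
  al * mcoeff k P2 + be * mcoeff k P1 + ga * mcoeff k P0.
Proof. by rewrite /mix !mcoeffD !mcoeffZ. Qed.

Lemma tofrac_mcoeffD n k (P Y : mpoly n R) i l :
  f (mcoeff k (P + i%:R * l%:R * Y)) =
  f (mcoeff k P) + i%:R * l%:R * f (mcoeff k Y).
Proof. by rewrite mcoeffD -!natrM !mulr_natl mcoeffMn tofracD tofracMn. Qed.

(* Modulo integral terms, the ghost components [phi^i (s)] may be replaced in
   [newton n] by the power sums of [x ^ (p ^ i)]; what remains is
   [\sum_m c_m newton m], [c_m] the coefficient of [q ^ m] in [F]. *)
Lemma smix_integral k :
  integral_in (\sum_(1 <= i < p * (mdeg k).+1) w i * mcoeff k (Sp i)).
Proof.
set B := (p * _)%N.
pose n0 m : L := f (mcoeff k (nu (fun j => qvar R 2 p j 0) m)).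
have n0_big m : (B <= m)%N -> n0 m = 0.
  move=> le_m; have q1 j : ord_ge 1 (qvar R 2 p j 0) by exact: ord_ge_mvar.
  by rewrite /n0 (ord_ge_newton p_odd q1 le_m) ?rmorph0.
have step i : (0 < i)%N -> exists2 e : L, integral_in e &
    w i * mcoeff k (Sp i) =
    w i * (al * n0 (p ^ 2 * i)%N + be * n0 (p * i)%N + ga * n0 i) + e.
  move=> i_gt0; have [y2 E2] := newton_ghost2 i_gt0.
  have [y1 E1] := newton_ghost1 i_gt0.
  (* The error [p i y] of each congruence cancels the denominator of [a_i / i], and its factor [p]
     makes [al] and [be] integral. *)
  exists (ratr (a i) * (p%:R * al) * f (mcoeff k y2) +
          ratr (a i) * (p%:R * be) * f (mcoeff k y1)).
    have ai := a_integral i_gt0.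
    by apply: integral_inD; apply: integral_inM; try (by eexists); exact: integral_inM.
  have S2 : mcoeff k (newton p (fun j => ghost2 p (qvar L 2 p j)) i) =
      n0 (p ^ 2 * i)%N + p%:R * i%:R * f (mcoeff k y2).
    rewrite -(map_mpoly_newton (T := fun j => ghost2 p (qvar R 2 p j))) => [|j].
      by rewrite mcoeff_map_mpoly E2; exact: tofrac_mcoeffD.
    by rewrite rmorph_ghost2; apply: eq_ghost2 => l _; exact: map_qvar.
  have S1 : mcoeff k (newton p (fun j => ghost1 p (qvar L 2 p j)) i) =
      n0 (p * i)%N + p%:R * i%:R * f (mcoeff k y1).
    rewrite -(map_mpoly_newton (T := fun j => ghost1 p (qvar R 2 p j))) => [|j].
      by rewrite mcoeff_map_mpoly E1; exact: tofrac_mcoeffD.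
    by rewrite rmorph_ghost1; apply: eq_ghost1 => l _; exact: map_qvar.
  have S0 : mcoeff k (newton p (fun j => qvar L 2 p j 0) i) = n0 i.
    rewrite -(map_mpoly_newton (T := fun j => qvar R 2 p j 0)) => [|j].
      by rewrite mcoeff_map_mpoly.
    exact: map_qvar.
  have -> : mcoeff k (Sp i) =
      al * (n0 (p ^ 2 * i)%N + p%:R * i%:R * f (mcoeff k y2)) +
      be * (n0 (p * i)%N + p%:R * i%:R * f (mcoeff k y1)) + ga * n0 i.
    by rewrite -S2 -S1 -S0; exact: mcoeff_mix.
  exact: split_integral_part (natL_neq0 i_gt0).
have /choice [e Ee] : forall i, exists e : L, (0 < i)%N -> integral_in e /\
    w i * mcoeff k (Sp i) =
    w i * (al * n0 (p ^ 2 * i)%N + be * n0 (p * i)%N + ga * n0 i) + e.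
  move=> i; have [i_gt0|_] := ltnP 0 i; last by exists 0.
  by have [e] := step i i_gt0; exists e.
rewrite (eq_big_nat _ _ (F2 := fun i =>
  w i * (al * n0 (p ^ 2 * i)%N + be * n0 (p * i)%N + ga * n0 i) + e i)); last first.
  by move=> i /andP [i_gt0 _]; case: (Ee i i_gt0).
rewrite big_split; apply: integral_inD; last first.
  rewrite big_seq; apply: integral_in_sum => i.
  by rewrite mem_index_iota => /andP [i_gt0 _]; case: (Ee i i_gt0).
(* With indicators the sums over [i] and [m] can be exchanged; the inner sum over [i] is then the
   coefficient given by [F_q]. *)
have n0E (j : nat) : n0 j = \sum_(m < B) n0 m * (j == m)%:R.
  have [lt_j|le_j] := ltnP j B.
    rewrite (bigD1 (Ordinal lt_j)) //= eqxx mulr1 big1 ?addr0 // => m m_neq.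
    rewrite [(j == m)](_ : _ = false) ?mulr0 //.
    by apply: contraNF m_neq => /eqP E; apply/eqP/val_inj.
  rewrite n0_big // big1 // => m _; rewrite gtn_eqF ?mulr0 //.
  exact: leq_trans (ltn_ord m) le_j.
have -> : \sum_(1 <= i < B)
    w i * (al * n0 (p ^ 2 * i)%N + be * n0 (p * i)%N + ga * n0 i) =
    \sum_(m < B) n0 m * f (F (mon3 m 0 0)).
  under [RHS]eq_bigr => m _ do rewrite (F_q (ltn_ord m)) mulr_sumr.
  rewrite exchange_big /=; apply: eq_bigr => i _.
  rewrite (n0E (p ^ 2 * i)%N) (n0E (p * i)%N) (n0E i) !mulr_sumr -!big_split mulr_sumr /=.
  by apply: eq_bigr => m _; ring.
apply: integral_in_sum => m _; apply: integral_inM; by eexists.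
Qed.

Local Notation DEL m := (@delta_poly p R phi 2 m).

Lemma ord_ge_iter_delta m k (P : mpoly (3 * m) R) :
  ord_ge 1 P -> ord_ge 1 (iter k (DEL m) P).
Proof.
by move=> P1; elim: k => // k IH; rewrite iterS; apply: (ord_ge_delta p_pr R_Rp phi_lift).
Qed.

Lemma ord_ge_elem_sym m j : ord_ge 1 (elem_sym R 2 m j).
Proof.
rewrite elem_symE; apply: ord_ge_sum => h /eqP h_card.
have [i i_in] : exists i, i \in h by apply/set0Pn; rewrite -card_gt0 h_card.
rewrite (bigD1 i) //=; apply: (@ord_geM _ _ 1 0) => //; exact: ord_ge_mvar.
Qed.

(** After clearing [1 / i], the first term is [p a_(i/p)] and the second [a_(p i)]: this is the
    Hecke relation. *)
Lemma Tp_eigen_coef x i (i_gt0 : (0 < i)%N) :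
  (if (p %| i)%N then w (i %/ p) * x else 0) + w (p * i) * p%:R * x
  = f lam * (w i * x).
Proof.
have p_neq0L := natL_neq0 p_gt0.
rewrite [w (p * i)]/(_ / _) natrM cancel_mul // [in RHS]mulrA mulrA -hecke_ratr //.
case: (boolP (p %| i)%N) => [/dvdnP [i' Ei]|_]; last by rewrite add0r addr0.
have i'_gt0 : (0 < i')%N by move: i_gt0; rewrite Ei; case: i' {Ei}.
rewrite Ei mulnK // natrM addrC -mulrDl; congr (_ * x).
by rewrite [in RHS]mulrDl; congr (_ + _); rewrite [i'%:R * _]mulrC -mulf_div divff // mul1r.
Qed.

(** By [smix_integral] the sum of the [smix] terms comes from a series [G] over [R], which serves as
    [G_(p)]. Both required identities are checked after embedding in [L], where [subst_family]
    reduces them to single terms. *)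
Lemma Tp_eigen_of_sum : Tp_eigen (r := 2) p phi F lam.
Proof.
have [G G_sum] := choice smix_integral.
have S_ord := ord_ge_smix p_pr p_odd al be ga.
have Q_ord := ord_ge_qmix p_pr al be ga.
exists G.
  apply: funext => mu; apply/eqP; rewrite -(@tofrac_eq R); apply/eqP.
  set B := (p * (mdeg mu).+1)%N.
  rewrite /delta_sym_subst (subst_family S_ord G_sum _ (leqnn B)); last first.
    by move=> l; apply: ord_ge_iter_delta; exact: ord_ge_elem_sym.
  under eq_bigr do rewrite (mmap_smix_delta_sym p_pr p_odd R_Rp phi_lift) //.
  rewrite /Sigma_ser rmorph_sum /=.
  under [RHS]eq_bigr => i _.
    rewrite /in_var (subst_family Q_ord F_sum _ (B := B)); first over.
      by move=> l; exact: ord_ge_mvar.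
    by rewrite mul1n leq_pmull.
  rewrite [RHS]exchange_big /=; apply: eq_bigr => n _.
  rewrite raddf_sum mulr_sumr; apply: eq_bigr => i _; congr (_ * mcoeff _ _).
  by rewrite (mmap_qmix p_pr p_odd al be ga (T := qvar L 2 p i)) // => l; exact: map_qvar.
move=> mu; apply/eqP; rewrite -(@tofrac_eq R) tofracD tofracM; apply/eqP.
set B := (mdeg mu).+1; pose x i := mcoeff mu (Qp i).
have x_big i : (B <= i)%N -> x i = 0 by move=> le_i; apply: (Q_ord i B); rewrite ?mul1n.
rewrite /Vp (subst_family Q_ord F_sum _ (B := B)); last 2 first.
- move=> l; apply: ord_ge_iter_delta.
  apply: ord_geW (@ord_geX _ _ 1 p _ (@ord_ge_mvar _ _ _)).
  by rewrite mul1n.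
- by rewrite mul1n.
under eq_bigr do rewrite (mmap_qmix_Vp p_pr p_odd R_Rp phi_lift).
rewrite /last_slots (subst_family S_ord G_sum _ (leqnn _)); last first.
  by move=> l; case: ifP => _; [exact: ord_ge_mvar|move=> k _; exact: mcoeff0].
under [X in _ + X]eq_bigr do rewrite (mmap_smix_last p_pr p_odd) //.
rewrite F_sum mul1n -/B mulr_sumr.
have -> : \sum_(1 <= i < B) w i * mcoeff mu (Qp (p * i)) =
    \sum_(1 <= i < B) (if (p %| i)%N then w (i %/ p) * x i else 0).
  rewrite (big_nat_mul B (fun i m => w i * x m)) // big_mkcond /=.
  rewrite (big_cat_nat (n := B)) //=; last by rewrite leq_pmull.
  rewrite [X in _ + X]big_nat [X in _ + X]big1 ?addr0 // => i /andP [le_i _].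
  by rewrite x_big // mulr0 if_same.
have -> : \sum_(1 <= i < p * B) w i *
      mcoeff mu (if (p %| i)%N then p%:R *: Qp (i %/ p) else 0) =
    \sum_(1 <= i < B) w (p * i) * p%:R * x i.
  rewrite (big_nat_mul B (fun i m => w m * p%:R * x i)) // [RHS]big_mkcond /=.
  apply: eq_bigr => i _; case: ifP => _; last by rewrite mcoeff0 mulr0.
  by rewrite mcoeffZ mulrA.
rewrite -big_split; apply: eq_big_nat => i /andP [i_gt0 _] /=.
by rewrite -Tp_eigen_coef.
Qed.

End TpEigen.

(** * The Hecke recursion *)

Lemma sum_expr_le2 (K : realFieldType) (x : K) n :
  0 <= x -> x <= 2^-1 -> \sum_(i < n) x ^+ i <= 2.
Proof.
move=> x_ge0 x_le; suff : \sum_(i < n) x ^+ i <= 2 - 2 * x ^+ n.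
  move/le_trans; apply; rewrite gerBl; apply: mulr_ge0 => //; exact: exprn_ge0.
elim: n => [|n IH]; first by rewrite big_ord0 expr0 mulr1 subrr.
rewrite big_ord_recr /=; apply: le_trans (lerD IH (lexx _)) _.
have : x * x ^+ n <= 2^-1 * x ^+ n by rewrite ler_wpM2r // exprn_ge0.
rewrite exprS; set u := x ^+ n; set v := x * u; lra.
Qed.

(** At the first non-zero [d k], the term of degree [k] dominates the tail for small [r].
    Convergence is asked only along partial sums of length [e * M], as these are the ones computed
    for the Hecke operator. *)
Lemma power_series_eq0 (K : realFieldType) (d : nat -> K) (e : nat) (rho B : K) :
  (0 < e)%N -> 0 < rho -> (forall m, `|d m| * rho ^+ m <= B) ->
  (forall r eps, 0 < r -> r < rho -> 0 < eps ->
     exists M0, forall M, (M0 <= M)%N -> `|\sum_(m < e * M) d m * r ^+ m| < eps) ->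
  forall m, d m = 0.
Proof.
move=> e_gt0 rho_gt0 dB dcvg; elim/ltn_ind => k IH; apply/eqP; apply: contraT => dk.
have B_ge0 : 0 <= B.
  by apply: le_trans (dB 0%N); rewrite mulr_ge0 // expr0.
have dk_gt0 : 0 < `|d k| by rewrite normr_gt0.
pose D := `|d k| * rho ^+ k; have D_gt0 : 0 < D by rewrite mulr_gt0 // exprn_gt0.
(* With [r = rho t], the bound [t <= 1/2] makes the geometric tail at most [2 B t ^ (k + 1)]. The
   final estimate [D <= t (1 + 2 B)] then contradicts [t (4 B + 4) <= D]. *)
pose t := Num.min 2^-1 (D / (4 * B + 4)).
have t_gt0 : 0 < t.
  by rewrite lt_min invr_gt0 ltr0n divr_gt0 //; lra.
have t_half : t <= 2^-1 by rewrite ge_min lexx.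
have tB : t * (4 * B + 4) <= D.
  by rewrite -ler_pdivlMr ?ge_min ?lexx ?orbT //; lra.
have r_lt : rho * t < rho by rewrite gtr_pMr //; lra.
have r_gt0 : 0 < rho * t by rewrite mulr_gt0.
have tk_gt0 : 0 < t ^+ k by rewrite exprn_gt0.
have [M0 HM0] := dcvg (rho * t) (t ^+ k.+1) r_gt0 r_lt (exprn_gt0 _ t_gt0).
pose M := maxn M0 k.+1.
have := HM0 M (leq_maxl _ _).
have lt_k : (k < e * M)%N.
  by apply: leq_trans (leq_pmull _ e_gt0); exact: leq_maxr.
rewrite -(big_mkord xpredT (fun m => d m * (rho * t) ^+ m)).
rewrite (big_cat_nat (n := k)) ?(ltnW lt_k) //= big_nat.
rewrite big1 => [|i /andP [_ lt_i]]; last first.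
  by rewrite IH // mul0r.
rewrite add0r big_ltn // => lt_eps.
have tail : `|\sum_(k.+1 <= i < e * M) d i * (rho * t) ^+ i| <= 2 * B * t ^+ k.+1.
  apply: le_trans (ler_norm_sum _ _ _) _.
  apply: (@le_trans _ _ (\sum_(k.+1 <= i < e * M) B * t ^+ i)).
    apply: ler_sum => i _; rewrite normrM (ger0_norm (exprn_ge0 i (ltW r_gt0))).
    by rewrite exprMn mulrA ler_wpM2r // exprn_ge0 // ltW.
  rewrite -mulr_sumr -{1}[k.+1]add0n big_addn big_mkord.
  under eq_bigr do rewrite exprD.
  rewrite -mulr_suml mulrA [2 * B]mulrC; apply: ler_wpM2r.
    by rewrite exprn_ge0 // ltW.
  by apply: ler_wpM2l => //; apply: sum_expr_le2 => //; exact: ltW.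
have : `|d k * (rho * t) ^+ k| <= t ^+ k.+1 + 2 * B * t ^+ k.+1.
  rewrite -[d k * _](addrK (\sum_(k.+1 <= i < e * M) d i * (rho * t) ^+ i)).
  by apply: le_trans (ler_normB _ _) _; apply: lerD => //; exact: ltW.
rewrite normrM (ger0_norm (exprn_ge0 k (ltW r_gt0))) exprMn mulrA -/D.
rewrite exprS -[t * _]/(t * t ^+ k) mulrA -mulrDl ler_pM2r //.
have : 2 * B * t <= t * (4 * B + 4) / 2 by nra.
nra.
Qed.

(** * The [q]-expansion of a newform on the imaginary axis *)

Section QExpansion.
Variable K : realType.
Local Notation C := K[i].
Implicit Types (x y : K).

Definition cis x : C := cos x +i* sin x.

Lemma cis0 : cis 0 = 1. Proof. by rewrite /cis cos0 sin0. Qed.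

Lemma cisD x y : cis (x + y) = cis x * cis y.
Proof. by rewrite /cis cosD sinD; simpc; congr (_ +i* _); rewrite addrC. Qed.

Lemma cisX x n : cis (n%:R * x) = cis x ^+ n.
Proof.
elim: n => [|n IH]; first by rewrite mul0r cis0.
by rewrite exprS -IH -cisD -nat1r mulrDl mul1r.
Qed.

Lemma cis_2pi : cis (2 * pi) = 1.
Proof. by rewrite mulr_natl /cis cos2pi sin2pi. Qed.

Lemma cis_root_neq1 p : (1 < p)%N -> cis (2 * pi / p%:R) != 1.
Proof.
move=> p_gt1; have p_gt0 : 0 < p%:R :> K by rewrite ltr0n ltnW.
have pi_gt0 := pi_gt0 K.
have x_gt0 : 0 < 2 * pi / p%:R :> K by rewrite divr_gt0 // mulr_gt0.
have x_le : 2 * pi / p%:R <= pi :> K.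
  by rewrite ler_pdivrMr // mulrC ler_pM2l // ler_nat.
apply/eqP => -[cos1 _]; have : 2 * pi / p%:R = 0 :> K.
  apply: cos_inj; last by rewrite cos0.
    by rewrite in_itv /= x_le ltW.
  by rewrite in_itv /= lexx ltW.
by move: x_gt0 => /[swap] ->; rewrite ltxx.
Qed.

Lemma sum_cis_root p n : prime p ->
  \sum_(j < p) (cis (2 * pi / p%:R) ^+ j) ^+ n = if (p %| n)%N then p%:R else 0.
Proof.
move=> p_pr; set z := cis _.
have p_neq0 : p%:R != 0 :> K by rewrite pnatr_eq0 -lt0n prime_gt0.
have zp : z ^+ p = 1 by rewrite -cisX mulrC divfK // cis_2pi.
have zE j : (z ^+ j) ^+ n = (z ^+ n) ^+ j by rewrite -!exprM mulnC.
under eq_bigr do rewrite zE.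
case: ifP => [/dvdnP [m ->]|ndvd].
  rewrite mulnC exprM zp expr1n.
  by under eq_bigr do rewrite expr1n; rewrite sumr_const card_ord.
have zn : z ^+ n - 1 != 0.
  rewrite subr_eq0; apply: contra_neqN (cis_root_neq1 (prime_gt1 p_pr)) => /eqP zn.
  have n_gt0 : (0 < n)%N by case: n ndvd {zE zn}; rewrite ?dvdn0.
  have cop : coprime n p by rewrite coprime_sym prime_coprime // ndvd.
  have [[u v] /= Euv] := coprimeP p n_gt0 cop.
  have Euv' : (u * n = v * p + 1)%N by lia.
  have := congr1 (fun k => z ^+ k) Euv'.
  by rewrite exprD mulnC exprM zn expr1n mulnC exprM zp expr1n mul1r expr1.
by apply: (mulfI zn); rewrite mulr0 -subrX1 -exprM mulnC exprM zp expr1n subrr.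
Qed.

Lemma qparE x y : qpar (x +i* y) = (expR (- 2 * pi * y))%:C * cis (2 * pi * x).
Proof. by []. Qed.

Lemma real_complexX x n : (x ^+ n)%:C = x%:C ^+ n.
Proof. exact: rmorphXn. Qed.

Lemma qpar_imag y : qpar (0 +i* y) = (expR (- 2 * pi * y))%:C.
Proof. by rewrite qparE mulr0 cis0 mulr1. Qed.

Lemma qpar_div (p j : nat) y : (0 < p)%N ->
  qpar ((0 +i* y + j%:R) / p%:R) =
  (expR (- 2 * pi * (y / p%:R)))%:C * cis (2 * pi / p%:R) ^+ j.
Proof.
move=> p_gt0.
have -> : (0 +i* y + j%:R) / p%:R = (j%:R / p%:R) +i* (y / p%:R) :> C.
  rewrite -!(rmorph_nat (real_complex K)) -fmorphV /=.
  by simpc; rewrite mulrC.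
rewrite qparE; congr (_ * _); rewrite -cisX; congr cis.
by rewrite mulrCA [_ / p%:R]mulrC; ring.
Qed.

Lemma qpar_mul (p : nat) y :
  qpar (p%:R * (0 +i* y)) = qpar (0 +i* y) ^+ p :> C.
Proof.
have -> : p%:R * (0 +i* y) = 0 +i* (p%:R * y) :> C.
  by rewrite -(rmorph_nat (real_complex K)); simpc.
by rewrite !qpar_imag -real_complexX -expRM_natl; congr ((expR _)%:C); ring.
Qed.

End QExpansion.

Lemma big_ord_mul (V : nmodType) (p B : nat) (G : nat -> nat -> V) : (0 < p)%N ->
  \sum_(i < B) G i (p * i)%N = \sum_(m < p * B | (p %| m)%N) G (m %/ p)%N m.
Proof.
move=> p_gt0; rewrite -(big_mkord xpredT (fun i => G i (p * i)%N)).
rewrite -(big_mkord (dvdn p) (fun m => G (m %/ p)%N m)).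
case: B => [|B]; first by rewrite muln0 !big_geq.
rewrite big_ltn // big_nat_mul // [RHS]big_ltn_cond ?muln_gt0 ?p_gt0 //.
by rewrite dvdn0 muln0 div0n.
Qed.

Section NewformHecke.
Variables (K : realType) (N : nat) (f : K[i] -> K[i]) (c : nat -> K[i]).
Local Notation C := K[i].

Lemma cvg0_Re (u : nat -> C) (e : K) :
  (u : nat -> C^o) @ \oo --> (0 : C^o) -> 0 < e ->
  exists M0, forall M, (M0 <= M)%N -> `|complex.Re (u M)| < e.
Proof.
move=> /cvgrPdist_lt u_cvg e_gt0.
have eC : 0 < e%:C by rewrite ltcR.
have [M0 _ HM0] := u_cvg _ eC; exists M0 => M le_M; have := HM0 M le_M.
by rewrite sub0r normrN => /(le_lt_trans (normc_ge_Re _)); rewrite ltcR.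
Qed.

Variables (a : nat -> rat) (p : nat).
Hypotheses (f_new : newform2 N f c) (cE : forall n, c n = ratr (a n)).
Hypotheses (p_pr : prime p) (p_N : ~~ (p %| N)%N).

Let p_gt0 : (0 < p)%N. Proof. exact: prime_gt0. Qed.
Local Notation al n := (ratr (a n) : K).

Let cR n : c n = (al n)%:C.
Proof. by rewrite cE -(fmorph_rat (real_complex K)). Qed.

Lemma f_series z : upper z ->
  series (fun n => c n * qpar z ^+ n : C^o) @ \oo --> (f z : C^o).
Proof. by case: f_new => _ _ [_ fE] _ _; exact: fE. Qed.

(** The terms of the convergent series at [i y] tend to 0; the finitely many initial ones are
    bounded by their sum. *)
Lemma coef_bounded (y : K) : 0 < y ->
  exists B, forall n, `|al n| * expR (- 2 * pi * y) ^+ n <= B.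
Proof.
move=> y_gt0; set s := expR _.
have s_ge0 : 0 <= s by exact: expR_ge0.
have upz : upper (0 +i* y : C) by [].
have := cvg_series_cvg_0 (cvgP _ (f_series upz)).
move=> /cvg0_Re /(_ ltr01) [M0 HM0].
exists (1 + \sum_(n < M0) `|al n| * s ^+ n) => n.
have sum_ge0 k : 0 <= \sum_(n < k) `|al n| * s ^+ n.
  by apply: sumr_ge0 => i _; rewrite mulr_ge0 // exprn_ge0.
have [le_n|lt_n] := leqP M0 n.
  have := HM0 n le_n; rewrite cR qpar_imag -real_complexX -rmorphM /= -/s.
  rewrite normrM (ger0_norm (exprn_ge0 n s_ge0)) => /ltW/le_trans; apply.
  by rewrite lerDl; exact: sum_ge0.
rewrite (bigD1 (Ordinal lt_n)) //= addrCA lerDl addr_ge0 //.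
by apply: sumr_ge0 => i _; rewrite mulr_ge0 // exprn_ge0.
Qed.

Variable lam : C.
Hypothesis lamP : forall z, upper z -> hecke2 N p f z = lam * f z.

(** The coefficient of [q ^ m] in [T_p f - lam f], with [lam] replaced by its real part: on the
    imaginary axis [q] is real, and so are the [a_n]. *)
Let d m : K :=
  al (p * m) + (if (p %| m)%N then p%:R * al (m %/ p) else 0)
  - complex.Re lam * al m.

Lemma hecke_partial_sums (y : K) (e : K) : 0 < y -> 0 < e ->
  exists M0, forall M, (M0 <= M)%N ->
    `|\sum_(m < p * M) d m * expR (- 2 * pi * y) ^+ m| < e.
Proof.
move=> y_gt0 e_gt0; set u := expR _.
have p_neq0 : p%:R != 0 :> K by rewrite pnatr_eq0 -lt0n.
pose z : C := 0 +i* y; pose zj j : C := (z + j%:R) / p%:R.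
have up_z : upper z by [].
have up_zj j : upper (zj j).
  rewrite /upper /zj -!(rmorph_nat (real_complex K)) -fmorphV /=.
  by rewrite /z /=; simpc; rewrite /= mulr_gt0 // invr_gt0 ltr0n.
have up_pz : upper (p%:R * z).
  rewrite /upper -(rmorph_nat (real_complex K)) /z; simpc.
  by rewrite /= mulr_gt0 // ltr0n.
pose S w M : C := series (fun n => c n * qpar w ^+ n : C^o) M.
(* The three lengths are chosen so that, after the sum over [j] has removed the exponents prime to
   [p], each part covers exactly the powers [u ^ m] with [m < p * M]. *)
pose T M : C := p%:R^-1 * \sum_(j < p) S (zj j) (p * (p * M))%N
  + p%:R * S (p%:R * z) M - lam * S z (p * M)%N.
have S_cvg w (g : nat -> nat) : upper w -> g @ \oo --> \oo ->
    (fun M => S w (g M) : C^o) @ \oo --> (f w : C^o).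
  by move=> /f_series f_cvg g_cvg; apply: cvg_comp f_cvg.
have mulp_cvg : muln p @ \oo --> \oo by exact: cvg_mulnl.
have T_cvg : (T : nat -> C^o) @ \oo --> (0 : C^o).
  have -> : 0 = p%:R^-1 * (\sum_(j < p) f (zj j)) + p%:R * f (p%:R * z) - lam * f z.
    have := lamP up_z; rewrite /hecke2 (negPf p_N) => ->.
    by rewrite subrr.
  apply: (@cvgB _ C^o); first apply: (@cvgD _ C^o).
  - apply: (@cvgMl_tmp C); apply: cvg_big => [|j _].
      exact: add_continuous.
    apply: S_cvg => //; exact: (cvg_comp _ _ mulp_cvg mulp_cvg).
  - apply: (@cvgMl_tmp C); apply: S_cvg => //; exact: cvg_id.
  - by apply: (@cvgMl_tmp C); apply: S_cvg.
have [M0 HM0] := cvg0_Re T_cvg e_gt0; exists M0 => M /HM0.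
suff -> : complex.Re (T M) = \sum_(m < p * M) d m * u ^+ m by [].
pose s := expR (- 2 * pi * (y / p%:R)).
have su : s ^+ p = u.
  by rewrite /s /u -expRM_natr; congr expR; field.
have pC_neq0 : p%:R != 0 :> C by rewrite pnatr_eq0 -lt0n.
have SE w k : S w k = \sum_(n < k) c n * qpar w ^+ n by rewrite /S /series /= big_mkord.
have E1 : p%:R^-1 * \sum_(j < p) S (zj j) (p * (p * M))%N =
    (\sum_(m < p * M) al (p * m) * u ^+ m)%:C.
  apply: (mulfI pC_neq0); rewrite mulVKf //.
  under eq_bigr do rewrite SE; rewrite exchange_big /=.
  transitivity (\sum_(n < p * (p * M) | (p %| n)%N) p%:R * (al n * s ^+ n)%:C).
    rewrite [RHS]big_mkcond /=; apply: eq_bigr => n _.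
    under eq_bigr do rewrite /zj qpar_div // exprMn mulrA.
    rewrite -mulr_sumr sum_cis_root // cR -real_complexX -rmorphM /=.
    by case: ifP => _; rewrite ?mulr0 // mulrC.
  rewrite -(big_ord_mul (p * M) (fun _ n => p%:R * (al n * s ^+ n)%:C)) //.
  rewrite rmorph_sum mulr_sumr; apply: eq_bigr => m _.
  by rewrite exprM su.
have E2 : p%:R * S (p%:R * z) M = (\sum_(m < p * M)
    (if (p %| m)%N then p%:R * al (m %/ p) else 0) * u ^+ m)%:C.
  transitivity (\sum_(m < p * M | (p %| m)%N) p%:R * (al (m %/ p) * u ^+ m)%:C).
    rewrite -(big_ord_mul M (fun i m => p%:R * (al i * u ^+ m)%:C)) //.
    rewrite SE mulr_sumr; apply: eq_bigr => m _.
    by rewrite cR qpar_mul qpar_imag -/u -exprM -real_complexX -rmorphM.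
  rewrite big_mkcond rmorph_sum; apply: eq_bigr => m _ /=.
  case: ifP => _; last by rewrite mul0r.
  by rewrite -(rmorph_nat (real_complex K)) -rmorphM /= mulrA.
have E3 : S z (p * M)%N = (\sum_(m < p * M) al m * u ^+ m)%:C.
  rewrite SE rmorph_sum; apply: eq_bigr => m _.
  by rewrite cR qpar_imag -/u -real_complexX -rmorphM.
have ReE (A D : K) : complex.Re (A%:C - lam * D%:C) = A - complex.Re lam * D.
  by case: (lam) => l1 l2; simpc.
rewrite /T E1 E2 E3 -rmorphD ReE.
rewrite mulr_sumr -big_split -sumrB; apply: eq_bigr => m _ /=.
by rewrite /d !mulrDl mulNr mulrA.
Qed.

End NewformHecke.

Lemma newform_hecke_recursion (K : realType) (N : nat) (f : K[i] -> K[i])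
    (c : nat -> K[i]) (a : nat -> rat) (p : nat) :
  newform2 N f c -> (forall n, c n = ratr (a n)) -> prime p -> ~~ (p %| N)%N ->
  forall n, a (p * n)%N + (if (p %| n)%N then p%:R * a (n %/ p)%N else 0)
            = a p * a n.
Proof.
move=> f_new cE p_pr p_N.
have [lam lamP] : exists lam, forall z, upper z -> hecke2 N p f z = lam * f z.
  by case: f_new => _ _ _ _; apply.
have a1 : a 1%N = 1.
  case: f_new => _ _ _ c1 _; move: c1; rewrite cE => /eqP.
  by rewrite fmorph_eq1 => /eqP.
have p_gt0 := prime_gt0 p_pr.
pose al n : K := ratr (a n); pose L := complex.Re lam.
pose d m : K :=
  al (p * m)%N + (if (p %| m)%N then p%:R * al (m %/ p)%N else 0) - L * al m.
have pi_gt0 := pi_gt0 K.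
have pR_gt0 : 0 < p%:R :> K by rewrite ltr0n.
pose s : K := expR (- 2 * pi * (1 / p%:R)).
have s_gt0 : 0 < s := expR_gt0 _.
have s_lt1 : s < 1.
  by rewrite expR_lt1 nmulr_rlt0 ?divr_gt0 //; lra.
have [B HB] := coef_bounded f_new cE (divr_gt0 ltr01 pR_gt0).
(* The radius is [s ^ p], so that [|a_(p m)|] is weighted by [s ^ (p m)], as in [HB]. The indices
   [m / p] and [m] are at most [p m] and [s < 1], so the same [B] bounds the other two terms. *)
have d0 : forall m, d m = 0.
  apply: (@power_series_eq0 K d p (s ^+ p) (B + p%:R * B + `|L| * B)) => //.
  - exact: exprn_gt0.
  - move=> m; rewrite -exprM.
    have spm_ge0 k : 0 <= s ^+ k by rewrite exprn_ge0 // ltW.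
    have bnd k : (k <= p * m)%N -> `|al k| * s ^+ (p * m) <= B.
      move=> le_k; apply: le_trans (HB k); rewrite ler_wpM2l // -/s.
      by rewrite ler_wiXn2l // ltW.
    apply: le_trans (ler_wpM2r (spm_ge0 _) (ler_normB _ _)) _; rewrite mulrDl.
    apply: lerD; last first.
      by rewrite normrM -mulrA ler_wpM2l // bnd // leq_pmull.
    apply: le_trans (ler_wpM2r (spm_ge0 _) (ler_normD _ _)) _; rewrite mulrDl.
    apply: lerD; first exact: bnd.
    case: ifP => _; last first.
      rewrite normr0 mul0r mulr_ge0 ?(ltW pR_gt0) //.
      by apply: le_trans (bnd 0%N _) => //; rewrite mulr_ge0.
    rewrite normrM (gtr0_norm pR_gt0) -mulrA; apply: (ler_wpM2l (ltW pR_gt0)).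
    apply: bnd.
    by rewrite (leq_trans (leq_div _ _)) // leq_pmull.
  - move=> r e r_gt0 r_lt e_gt0.
    have r_lt1 : r < 1.
      by apply: lt_le_trans r_lt _; rewrite exprn_ile1 // ltW.
    pose y := - ln r / (2 * pi).
    have y_gt0 : 0 < y.
      by rewrite divr_gt0 // ?mulr_gt0 // oppr_gt0 ln_lt0 // r_gt0.
    have ry : expR (- 2 * pi * y) = r.
      have cancel_y (q l : K) : q != 0 -> - 2 * q * (- l / (2 * q)) = l.
        by move=> q_neq0; field.
      by rewrite /y cancel_y ?gt_eqF // lnK ?posrE.
    have [M0 HM0] := hecke_partial_sums f_new cE p_pr p_N lamP y_gt0 e_gt0.
    by exists M0 => M /HM0; rewrite ry.
(* The relation for [m = 1], where [a_1 = 1], identifies the eigenvalue. *)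
have LE : L = al p.
  have := d0 1%N; rewrite /d muln1 dvdn1 gtn_eqF ?prime_gt1 // addr0 /al a1.
  by rewrite rmorph1 mulr1 => /eqP; rewrite subr_eq0 => /eqP ->.
move=> n; apply: (fmorph_inj (ratr : rat -> K)).
have := d0 n; rewrite /d LE => /eqP; rewrite subr_eq0 => /eqP.
rewrite rmorphD rmorphM /= => <-; congr (_ + _); case: ifP => _.
  by rewrite rmorphM /= rmorph_nat.
by rewrite rmorph0.
Qed.

(** * The two shapes of the series *)

Section SharpSeries.
Variables (p : nat) (R : idomainType).
Hypotheses (p_pr : prime p) (R_Rp : is_Rp p R).
Local Notation L := {fraction R}.
Local Notation f := (@tofrac R).
Variables (a : nat -> rat) (F : mser (3 * 1) R).
Local Notation w n := (ratr (a n) / n%:R : L).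

Let p_neq0L : p%:R != 0 :> L.
Proof. by apply: (fraction_natr_neq0 p_pr R_Rp); exact: prime_gt0. Qed.

Lemma series_sum_mix (P2 P1 P0 : nat -> mpoly (3 * 1) L) al be ga c k :
  c * series_sum a (fun n => al *: P2 n + be *: P1 n + ga *: P0 n) k =
  \sum_(1 <= i < 1 * (mdeg k).+1)
    w i * mcoeff k (mix (c * al) (c * be) (c * ga) (P2 i) (P1 i) (P0 i)).
Proof.
rewrite /series_sum mulr_sumr mul1n; apply: eq_bigr => i _.
by rewrite mcoeff_mix !mcoeffD !mcoeffZ mulrCA !mulrDr !mulrA.
Qed.

Lemma series_a_sum : series_a p a F -> forall k,
  f (F k) = \sum_(1 <= i < 1 * (mdeg k).+1)
    w i * mcoeff k (qmix p p%:R^-1 (- (ratr (a p) / p%:R)) 1 i).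
Proof.
move=> Fa k; rewrite -[LHS]/(inL _) Fa.
have -> : series_sum a (fun n => q_phi2 p R ^+ n - ratr (a p) *: q_phi p R ^+ n
      + p%:R *: qvar L 2 1 0 0 ^+ n) k =
    series_sum a (fun n => 1 *: q_phi2 p R ^+ n + (- ratr (a p)) *: q_phi p R ^+ n
      + p%:R *: qvar L 2 1 0 0 ^+ n) k.
  by apply: eq_bigr => n _; rewrite scale1r scaleNr.
rewrite series_sum_mix; apply: eq_bigr => i _; rewrite mulr1 mulVf //.
by rewrite mulrN [_^-1 * _]mulrC.
Qed.

Lemma series_b_sum u : series_b p a u F -> forall k,
  f (F k) = \sum_(1 <= i < 1 * (mdeg k).+1)
    w i * mcoeff k (qmix p 0 p%:R^-1 (- f u) i).
Proof.
move=> Fb k; rewrite -[LHS]/(inL _) Fb.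
have -> : series_sum a (fun n => q_phi p R ^+ n
      - (p%:R * inL u) *: qvar L 2 1 0 0 ^+ n) k =
    series_sum a (fun n => 0 *: q_phi2 p R ^+ n + 1 *: q_phi p R ^+ n
      + (- (p%:R * inL u)) *: qvar L 2 1 0 0 ^+ n) k.
  by apply: eq_bigr => n _; rewrite scale0r add0r scale1r scaleNr.
rewrite series_sum_mix; apply: eq_bigr => i _; rewrite mulr0 mulr1 mulrN mulrA.
by rewrite mulVf // mul1r.
Qed.

(** At [q = q'' = 0], [phi q] is [p q'], while [phi^2 q] only contains the [p]-th power of [q']. *)
Lemma mcoeff_qmix_q' (al be ga : L) :
  mcoeff (mon3 0 1 0) (qmix p al be ga 1) = be * p%:R.
Proof.
have c1P : (1 < 3 * 1)%N by [].
pose c1 := Ordinal c1P.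
have p_gt0 := prime_gt0 p_pr; have p_gt1 := prime_gt1 p_pr.
rewrite -(@coef_pure_poly _ _ c1 1); last first.
  by move=> k; rewrite /mon3 multinomE tnth_mktuple; case: k => [[|[|[|k]]]].
have pureq k : pure_poly c1 (qvar L 2 1 0 k) = if k == 1%N then 'X else 0.
  rewrite /qvar /mvar; case: insubP => [i0 _ Ei0|].
    rewrite /pure_poly mmapX mmap1U; congr (if _ then _ else _).
    by rewrite -val_eqE /= Ei0 muln1 addn0.
  by case: k => [|[|k]] //= _; rewrite rmorph0.
have pure1 : pure_poly c1 (ghost1 p (qvar L 2 1 0)) = p%:R * 'X.
  by rewrite rmorph_ghost1 /ghost1 /= !pureq /= expr0n gtn_eqF // add0r.
have pure2 : pure_poly c1 (ghost2 p (qvar L 2 1 0)) = (p%:R * 'X) ^+ p + p%:R * 'X ^+ p.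
  rewrite rmorph_ghost2 /ghost2 /= !pureq /= expr0n gtn_eqF // add0r.
  by rewrite mulr0 addr0.
have pureZ c P : pure_poly c1 (c *: P) = c%:P * pure_poly c1 P by exact: mmapZ.
have pure_mix P2 P1 P0 : pure_poly c1 (mix al be ga P2 P1 P0) =
    al%:P * pure_poly c1 P2 + be%:P * pure_poly c1 P1 + ga%:P * pure_poly c1 P0.
  by rewrite /mix !rmorphD /= !pureZ.
rewrite pure_mix !expr1 pure1 pure2 pureq /= mulr0 addr0 coefD !coefCM.
rewrite !mulr_natl exprMn_n coefD !coefMn coefXn coefX ltn_eqF // !mul0rn addr0.
by rewrite mulr0 add0r mulr_natr.
Qed.

(** The coefficient of [q'] in [F] comes from [n = 1] alone and equals [- a_p], which shows that
    [a_p] lies in [R]. *)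
Lemma lam_series_a : a 1%N = 1 -> series_a p a F -> exists lam, f lam = ratr (a p).
Proof.
move=> a1 /series_a_sum/(_ (mon3 0 1 0)); rewrite mdeg_mon3 mul1n big_nat1.
rewrite mcoeff_qmix_q' a1 mulNr divfK // => E.
exists (- F (mon3 0 1 0)); rewrite tofracN E.
have -> : ratr 1 = 1 :> L by exact: (ratr_nat L 1).
by rewrite divr1 mul1r opprK.
Qed.

(** The roots of [x ^ 2 - a_p x + p] have product [p], so the root other than [p u] is [u^-1]; their
    sum is [a_p]. *)
Lemma lam_is_u u : is_u p a u -> f (p%:R * u + u^-1) = ratr (a p).
Proof.
move=> [_ u_unit]; rewrite /inL.
have u_neq0 : f u != 0 by rewrite tofrac_eq0; apply: contraTneq u_unit => ->; rewrite unitr0.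
have -> : f (p%:R * u + u^-1) = p%:R * f u + (f u)^-1.
  rewrite tofracD tofracM rmorph_nat; congr (_ + _).
  by apply: (mulfI u_neq0); rewrite -rmorphM divrr // rmorph1 divff.
move=> E; apply: (mulIf (mulf_neq0 p_neq0L u_neq0)).
move/eqP: E; rewrite addrAC subr_eq0 => /eqP <-.
by rewrite mulrDl expr2; congr (_ + _); rewrite mulrCA mulVf // mulr1.
Qed.

End SharpSeries.

(** * The eigenvalue in cases (a) and (b) *)

Theorem proposition9p9 (K : realType) (N : nat) (f : K[i] -> K[i])
    (c : nat -> K[i]) (a : nat -> rat) :
  (0 < N)%N ->
  newform2 N f c ->
  coef_field c = @rationals K ->
  (forall n, c n = ratr (a n)) ->
  exists p0 : nat, forall p : nat,
    (p0 <= p)%N -> (5 <= p)%N -> prime p -> ~~ (p %| N)%N ->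
  forall (R : idomainType) (phi : {rmorphism R -> R}),
    is_Rp p R -> Frobenius_lift p phi ->
  forall rho : K[i] -> R,
    ring_embedding (@cyclo_ring K N) rho ->
  forall (S : prolongation p phi) (j : (nat -> R) -> S 0%N)
      (T : triple (S 0%N) N),
    fourier_sequence j -> is_tate j (rho (@zetaN K N)) T ->
  forall (fsharp : dform p N phi 2) (F : mser (3 * 1) R),
    sharp_series N f a p F ->
    unique_eigenform j T F fsharp ->
  exists2 lam : R, tofrac lam = ratr (a p) & Tp_eigen (r := 2) p phi F lam.
Proof.
move=> _ f_new _ cE; exists 0%N => p _ p_ge5 p_pr p_N R phi R_Rp phi_lift.
move=> rho _ S j T _ _ fsharp F F_sharp _ {rho S j T fsharp}.
have p_odd : odd p by case: (even_prime p_pr) => // p2; rewrite p2 in p_ge5.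
have a1 : a 1%N = 1.
  case: f_new => _ _ _ c1 _; move: c1; rewrite cE => /eqP.
  by rewrite fmorph_eq1 => /eqP.
have hecke_a n (_ : (0 < n)%N) := newform_hecke_recursion f_new cE p_pr p_N n.
have p_neq0 : p%:R != 0 :> {fraction R}.
  by apply: (fraction_natr_neq0 p_pr R_Rp); exact: prime_gt0.
case: F_sharp => [[_ Fa]|[_ [u u_root Fb]]].
(* Case (a): [p al = 1], [p be = - a_p] and [ga = 1]. *)
- have [lam lamE] := lam_series_a p_pr R_Rp a1 Fa; exists lam => //.
  apply: (Tp_eigen_of_sum p_pr p_odd R_Rp phi_lift hecke_a _ _ _ _ lamE
    (series_a_sum p_pr R_Rp Fa)).
  + by rewrite divff //; exact: (integral_in_nat R 1).
  + by rewrite mulrN mulrC divfK // -lamE; apply: integral_inN; exists lam.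
  + exact: oner_neq0.
  + by rewrite invr1; exact: (integral_in_nat R 1).
(* Case (b): [p al = 0], [p be = 1], and [ga = - u] is invertible in [R]. *)
- have lamE := lam_is_u p_pr R_Rp u_root; exists (p%:R * u + u^-1) => //.
  have [_ u_unit _] := u_root.
  apply: (Tp_eigen_of_sum p_pr p_odd R_Rp phi_lift hecke_a _ _ _ _ lamE
    (series_b_sum p_pr R_Rp Fb)).
  + by rewrite mulr0; exact: (integral_in_nat R 0).
  + by rewrite divff //; exact: (integral_in_nat R 1).
  + rewrite oppr_eq0 tofrac_eq0.
    by apply: contraTneq u_unit => ->; rewrite unitr0.
  + by rewrite invrN; apply: integral_inN; exact: integral_inV.
Qed.
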